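(* A $\mathbb{Z}_2$-symmetric graph $G$ is $(2,2)$-$C_i$-tight if and only if $G$ can be generated from $F_1$ or $F_2$ (with their involutions as described) by a finite sequence of the following operations: symmetrised 0-extensions, symmetrised 1-extensions, symmetrised vertex-to-$K_4$ operations, symmetrised vertex-to-$C_4$ operations at non-fixed vertices, and joining two graphs already so generated by two new edges $xy,x'y'$ (with $x$ in the first graph and $y$ in the second).
   Context: A $\mathbb{Z}_2$-symmetric graph is a finite simple graph $G=(V,E)$ with an automorphism $\theta$, $\theta^2=\mathrm{id}$; write $v'=\theta(v)$; graphs are considered up to isomorphisms commuting with the involutions. A vertex is fixed if $v'=v$; an edge $uv$ is fixed if $\{u',v'\}=\{u,v\}$. $G$ is $(2,2)$-sparse if every subgraph $(V',E')$ with $V'\ne\emptyset$ has $|E'|\le2|V'|-2$, $(2,2)$-tight if also $|E|=2|V|-2$; $(2,2)$-$C_i$-tight if $(2,2)$-tight and $\theta$ fixes no vertex and no edge. Base graphs: $F_1$ has vertices $a,b,c,d,e,f$, edges all pairs between $\{c,d\}$ and $\{a,b,e,f\}$ plus $ab,ef$, involution $a\leftrightarrow f$, $b\leftrightarrow e$, $c\leftrightarrow d$. $F_2$ consists of two disjoint copies of $K_4$ on $\{a_1,a_2,a_3,a_4\}$ and $\{b_1,b_2,b_3,b_4\}$ plus edges $a_3b_3$, $a_4b_4$, with involution $a_1\leftrightarrow b_1$, $a_2\leftrightarrow b_2$, $a_3\leftrightarrow b_4$, $a_4\leftrightarrow b_3$. Operations (new vertices always come in pairs $s,s'$ swapped by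 the extended involution, and the result is required to be simple): - symmetrised 0-extension: add $v,v'$, $v$ adjacent to distinct $a,b$, $v'$ adjacent to $a',b'$; - symmetrised 1-extension: for a non-fixed edge $ab$ and a vertex $c\notin\{a,b\}$, delete $ab,a'b'$, add $v$ adjacent to $a,b,c$ and $v'$ adjacent to $a',b',c'$; - symmetrised vertex-to-$K_4$: at a non-fixed vertex $w$, add $a,b,c,a',b',c'$ making $\{w,a,b,c\}$ and $\{w',a',b',c'\}$ cliques, and for each former neighbour $u$ of $w$ replace the edge $wu$ by $d_uu$ for a chosen $d_u\in\{w,a,b,c\}$, doing the image choice at $w'$; - symmetrised vertex-to-$C_4$ at a non-fixed vertex $w$: choose distinct neighbours $v_1,v_2$ of $w$, add $u$ adjacent to $v_1,v_2$ (keeping $wv_1,wv_2$), move any subset of the remaining edges $wv_i$ to $uv_i$, and do the image operation at $w'$ with $u'$; - joining: disjoint union of two such graphs plus edges $xy,x'y'$. *)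

(* Defs.v *)
From HB Require Import structures.
From mathcomp Require Import all_boot.
Set Implicit Arguments. Unset Strict Implicit. Unset Printing Implicit Defensive.

Record z2graph := Z2Graph { zV : finType; zadj : rel zV; zinv : zV -> zV }.
Arguments zadj : clear implicits.
Arguments zinv : clear implicits.

Definition z2_wf (G : z2graph) : Prop :=
  [/\ (forall x y : zV G, zadj G x y = zadj G y x),
      (forall x : zV G, ~~ zadj G x x),
      (forall x : zV G, zinv G (zinv G x) = x) &
      (forall x y : zV G, zadj G (zinv G x) (zinv G y) = zadj G x y)].

Definition zedges (G : z2graph) : {set {set zV G}} :=
  [set e : {set zV G} | [exists x, exists y, zadj G x y && (e == [set x; y])]].

Definition sparse22 (G : z2graph) : Prop :=
  forall (S : {set zV G}) (F : {set {set zV G}}),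
    S != set0 -> F \subset zedges G -> (forall e, e \in F -> e \subset S) ->
    #|F| + 2 <= 2 * #|S|.

Definition tight22 (G : z2graph) : Prop :=
  sparse22 G /\ #|zedges G| + 2 = 2 * #|[set: zV G]|.

Definition ci_tight (G : z2graph) : Prop :=
  [/\ tight22 G,
      (forall x : zV G, zinv G x != x) &
      (forall x y : zV G, zadj G x y -> [set zinv G x; zinv G y] != [set x; y])].

Definition z2iso (G H : z2graph) : Prop :=
  exists f : zV G -> zV H,
    [/\ bijective f,
        (forall x y, zadj H (f x) (f y) = zadj G x y) &
        (forall x, f (zinv G x) = zinv H (f x))].

Definition adj_of_list n (l : seq (nat * nat)) : rel 'I_n :=
  fun x y => ((val x, val y) \in l) || ((val y, val x) \in l).

(* F1: a,b,c,d,e,f = 0,1,2,3,4,5; involution a<->f, b<->e, c<->d, i.e. i |-> 5-i *)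
Definition F1 : z2graph :=
  @Z2Graph 'I_6
    (@adj_of_list 6 [:: (2,0); (2,1); (2,4); (2,5); (3,0); (3,1); (3,4); (3,5);
                       (0,1); (4,5)])
    (fun i => inord (5 - i)).

(* F2: a1..a4 = 0..3, b1..b4 = 4..7 *)
Definition F2_inv (n : nat) : nat :=
  match n with
  | 0 => 4 | 1 => 5 | 2 => 7 | 3 => 6 | 4 => 0 | 5 => 1 | 6 => 3 | 7 => 2 | _ => 0
  end.

Definition F2 : z2graph :=
  @Z2Graph 'I_8
    (@adj_of_list 8 [:: (0,1); (0,2); (0,3); (1,2); (1,3); (2,3);
                       (4,5); (4,6); (4,7); (5,6); (5,7); (6,7);
                       (2,6); (3,7)])
    (fun i => inord (F2_inv i)).

Definition sym_rel (T : Type) (r : rel T) : rel T := fun x y => r x y || r y x.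

(* new vertices: inr true = s, inr false = s' *)
Definition swapb (T : Type) (t : T -> T) (z : T + bool) : T + bool :=
  match z with inl x => inl (t x) | inr b => inr (~~ b) end.

Definition same_pair (T : eqType) (x y u v : T) : bool :=
  ((x == u) && (y == v)) || ((x == v) && (y == u)).

Definition ext0_raw (G : z2graph) (a b : zV G) : rel (zV G + bool) :=
  fun p q =>
    match p, q with
    | inl x, inl y => zadj G x y
    | inr true, inl x => (x == a) || (x == b)
    | inr false, inl x => (x == zinv G a) || (x == zinv G b)
    | _, _ => false
    end.

Definition ext0 (G : z2graph) (a b : zV G) : z2graph :=
  @Z2Graph (zV G + bool)%type (sym_rel (ext0_raw a b)) (swapb (zinv G)).

Definition ext1_raw (G : z2graph) (a b c : zV G) : rel (zV G + bool) :=
  fun p q =>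
    match p, q with
    | inl x, inl y => [&& zadj G x y, ~~ same_pair x y a b
                        & ~~ same_pair x y (zinv G a) (zinv G b)]
    | inr true, inl x => [|| x == a, x == b | x == c]
    | inr false, inl x => [|| x == zinv G a, x == zinv G b | x == zinv G c]
    | _, _ => false
    end.

Definition ext1 (G : z2graph) (a b c : zV G) : z2graph :=
  @Z2Graph (zV G + bool)%type (sym_rel (ext1_raw a b c)) (swapb (zinv G)).

(** Symmetrised vertex-to-K4 at w.  New vertices inr (true,i) (i < 3) are
    a,b,c; inr (false,i) are a',b',c'.  For each old vertex u, [d u] is the
    choice d_u: [None] means w itself, [Some i] the i-th new vertex. The edge
    w u (u a neighbour of w) is replaced by d_u u; the edge w' u' by the image
    (d_u)' u'. *)
Definition swapK4 (T : Type) (t : T -> T) (z : T + (bool * 'I_3)) : T + (bool * 'I_3) :=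
  match z with inl x => inl (t x) | inr (b, i) => inr (~~ b, i) end.

Definition k4_raw (G : z2graph) (w : zV G) (d : zV G -> option 'I_3)
  : rel (zV G + (bool * 'I_3)) :=
  fun p q =>
    let w' := zinv G w in
    match p, q with
    | inl x, inl y =>
        [&& zadj G x y,
            ~~ ((x == w) && (d y != None)), ~~ ((y == w) && (d x != None)),
            ~~ ((x == w') && (d (zinv G y) != None))
          & ~~ ((y == w') && (d (zinv G x) != None))]
    | inr (true, i), inl x => (x == w) || (zadj G w x && (d x == Some i))
    | inr (false, i), inl x => (x == w') || (zadj G w' x && (d (zinv G x) == Some i))
    | inr (b1, i), inr (b2, j) => (b1 == b2) && (i != j)
    | _, _ => false
    end.

Definition vertex_to_K4 (G : z2graph) (w : zV G) (d : zV G -> option 'I_3) : z2graph :=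
  @Z2Graph (zV G + (bool * 'I_3))%type (sym_rel (k4_raw w d)) (swapK4 (zinv G)).

(** Symmetrised vertex-to-C4 at w: new u = inr true adjacent to v1, v2 (edges
    w v1, w v2 kept); every other edge w x with [M x] is moved to u x; image
    operation at w' with u' = inr false. *)
Definition c4_raw (G : z2graph) (w v1 v2 : zV G) (M : pred (zV G))
  : rel (zV G + bool) :=
  fun p q =>
    let w' := zinv G w in
    let mv x := [&& zadj G w x, x != v1, x != v2 & M x] in
    let mv' x := [&& zadj G w' x, zinv G x != v1, zinv G x != v2 & M (zinv G x)] in
    match p, q with
    | inl x, inl y =>
        [&& zadj G x y,
            ~~ ((x == w) && mv y), ~~ ((y == w) && mv x),
            ~~ ((x == w') && mv' y) & ~~ ((y == w') && mv' x)]
    | inr true, inl x => [|| x == v1, x == v2 | mv x]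
    | inr false, inl x => [|| x == zinv G v1, x == zinv G v2 | mv' x]
    | _, _ => false
    end.

Definition vertex_to_C4 (G : z2graph) (w v1 v2 : zV G) (M : pred (zV G)) : z2graph :=
  @Z2Graph (zV G + bool)%type (sym_rel (c4_raw w v1 v2 M)) (swapb (zinv G)).

Definition join_raw (G1 G2 : z2graph) (x : zV G1) (y : zV G2)
  : rel (zV G1 + zV G2) :=
  fun p q =>
    match p, q with
    | inl a, inl b => zadj G1 a b
    | inr a, inr b => zadj G2 a b
    | inl a, inr b => ((a == x) && (b == y)) || ((a == zinv G1 x) && (b == zinv G2 y))
    | _, _ => false
    end.

Definition join_inv (G1 G2 : z2graph) (p : zV G1 + zV G2) : zV G1 + zV G2 :=
  match p with inl a => inl (zinv G1 a) | inr b => inr (zinv G2 b) end.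

Definition zjoin (G1 G2 : z2graph) (x : zV G1) (y : zV G2) : z2graph :=
  @Z2Graph (zV G1 + zV G2)%type (sym_rel (join_raw x y)) (@join_inv G1 G2).

Inductive generated : z2graph -> Prop :=
  | gen_F1 (H : z2graph) : z2iso F1 H -> generated H
  | gen_F2 (H : z2graph) : z2iso F2 H -> generated H
  | gen_ext0 (G H : z2graph) (a b : zV G) :
      generated G -> a != b -> z2iso (ext0 a b) H -> generated H
  | gen_ext1 (G H : z2graph) (a b c : zV G) :
      generated G -> zadj G a b -> ~~ same_pair (zinv G a) (zinv G b) a b ->
      c != a -> c != b -> z2iso (ext1 a b c) H -> generated H
  | gen_K4 (G H : z2graph) (w : zV G) (d : zV G -> option 'I_3) :
      generated G -> zinv G w != w -> ~~ zadj G w (zinv G w) ->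
      z2iso (vertex_to_K4 w d) H -> generated H
  | gen_C4 (G H : z2graph) (w v1 v2 : zV G) (M : pred (zV G)) :
      generated G -> zinv G w != w -> ~~ zadj G w (zinv G w) ->
      v1 != v2 -> zadj G w v1 -> zadj G w v2 ->
      z2iso (vertex_to_C4 w v1 v2 M) H -> generated H
  | gen_join (G1 G2 H : z2graph) (x : zV G1) (y : zV G2) :
      generated G1 -> generated G2 ->
      ~~ ((zinv G1 x == x) && (zinv G2 y == y)) ->
      z2iso (zjoin x y) H -> generated H.

(* Main.v *)
(** Write f(U) = 2|U| - i(U), where i(U) is the number of edges inside U.  Then f >= 2
    on nonempty sets, U is tight when f(U) = 2, and f is submodular, so two tight sets
    that meet have tight union and intersection, with no edge between their differences.
    If the involution t fixes no vertex and no edge, f is even on t-invariant sets; this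
    parity makes the two symmetric copies of a local argument compatible.

    The operations preserve tightness by counting.  Conversely, argue by induction on the
    number of vertices.  The degrees sum to 4|V| - 4, so there are vertices of degree 2 or 3,
    and degree 2 inverts a 0-extension.  Let v have neighbours x, y, z.  A pair such as x, y
    cannot be used to invert a 1-extension only if x y is an edge, or y = t x, or some tight
    set avoiding v and t v contains x and y.  Submodularity leaves two possibilities when all
    three pairs are unusable: v, x, y, z span K4, or y = t x and the six vertices v, x, z and
    their images span F1.  In the K4 case, if K4 is joined to its image they span F2; if some
    vertex outside has two neighbours in the K4, a vertex-to-C4 operation can be inverted;
    otherwise the K4 can be contracted.

    There remains the case in which every vertex of degree 3 lies in a copy of F1 or F2.
    These copies are minimal invariant tight sets, hence pairwise disjoint, and if none of
    them is everything then degree counting gives one with at most 3, hence exactly 2,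
    outgoing edges, so that the graph is a join. *)

Require Import Defs.
From mathcomp Require Import all_boot zify.
Set Implicit Arguments. Unset Strict Implicit. Unset Printing Implicit Defensive.

(** * Edge counts *)

Section Count.
Variables (V : finType) (r : rel V).
Implicit Types A B C U : {set V}.

(* Ordered pairs: [cnt A A] is twice the number of edges inside A, so that
   (2,2)-sparsity reads [cnt U U + 4 <= 4 * #|U|]. *)
Definition cnt A B : nat := \sum_(x in A) \sum_(y in B) r x y.

Lemma cnt0l B : cnt set0 B = 0.
Proof. by rewrite /cnt big_set0. Qed.

Lemma cntIDl B A C : cnt A C = cnt (A :&: B) C + cnt (A :\: B) C.
Proof. by rewrite /cnt (big_setID B). Qed.

Lemma cntIDr B A C : cnt C A = cnt C (A :&: B) + cnt C (A :\: B).
Proof. by rewrite /cnt -big_split /=; apply: eq_bigr => x _; rewrite (big_setID B). Qed.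

Lemma setU_ID A B : [disjoint A & B] -> (A :|: B) :&: A = A /\ (A :|: B) :\: A = B.
Proof.
move=> /pred0P dAB; split; apply/setP=> x; have /= := dAB x; rewrite !inE.
  by case: (x \in A); rewrite ?andbF.
by case: (x \in A) => //= ->.
Qed.

Lemma cntUl A B C : [disjoint A & B] -> cnt (A :|: B) C = cnt A C + cnt B C.
Proof. by move=> /setU_ID[I D]; rewrite (cntIDl A) I D. Qed.

Lemma cntUr A B C : [disjoint B & C] -> cnt A (B :|: C) = cnt A B + cnt A C.
Proof. by move=> /setU_ID[I D]; rewrite (cntIDr B) I D. Qed.

Lemma cnt11 x y : cnt [set x] [set y] = r x y.
Proof. by rewrite /cnt !big_set1. Qed.

Lemma cnt1l x B : cnt [set x] B = \sum_(y in B) r x y.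
Proof. by rewrite /cnt big_set1. Qed.

Lemma cntE A B : cnt A B = \sum_(x in A) cnt [set x] B.
Proof. by apply: eq_bigr => x _; rewrite cnt1l. Qed.

Lemma cnt_card A B :
  cnt A B = #|[set p : V * V | [&& p.1 \in A, p.2 \in B & r p.1 p.2]]|.
Proof.
rewrite -sum1_card (eq_bigl (fun p => (p.1 \in A) && ((p.2 \in B) && r p.1 p.2))); last first.
  by move=> p; rewrite inE.
rewrite -(pair_big_dep (mem A) (fun x y => (y \in B) && r x y) (fun _ _ => 1)) /=.
by apply: eq_bigr => x _; rewrite -big_mkcondr.
Qed.

Lemma cnt_subr A B C : B \subset C -> cnt A B <= cnt A C.
Proof. by move=> sBC; rewrite (cntIDr B C) (setIidPr sBC) leq_addr. Qed.

Lemma cnt_subl A B C : A \subset B -> cnt A C <= cnt B C.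
Proof. by move=> sAB; rewrite (cntIDl A B) (setIidPr sAB) leq_addr. Qed.

Lemma cnt_ge1 A B x y : x \in A -> y \in B -> r x y -> 0 < cnt A B.
Proof.
move=> xA yB rxy; rewrite cnt_card; apply/card_gt0P; exists (x, y).
by rewrite inE /= xA yB.
Qed.

Lemma cnt_ge2 A B x y z w : x \in A -> y \in B -> z \in A -> w \in B ->
  r x y -> r z w -> (x, y) != (z, w) -> 1 < cnt A B.
Proof.
move=> xA yB zA wB rxy rzw n; rewrite cnt_card; apply/card_gt1P.
by exists (x, y), (z, w); rewrite !inE /= xA yB zA wB.
Qed.

Lemma cnt_eq0 A B : cnt A B = 0 -> forall x y, x \in A -> y \in B -> r x y = false.
Proof.
move=> c0 x y xA yB; apply/negP => rxy; have := cnt_ge1 xA yB rxy.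
by rewrite c0.
Qed.

Lemma cnt_0 A B : (forall x y, x \in A -> y \in B -> r x y = false) -> cnt A B = 0.
Proof. by move=> H; rewrite /cnt big1 // => x xA; rewrite big1 // => y yB; rewrite H. Qed.

Lemma cnt_seq (s1 s2 : seq V) : uniq s1 -> uniq s2 ->
  cnt [set x in s1] [set x in s2] = \sum_(x <- s1) \sum_(y <- s2) r x y.
Proof.
move=> u1 u2; rewrite /cnt big_uniq //=; apply: eq_big => [x|x _]; first by rewrite inE.
by rewrite [RHS]big_uniq //=; apply: eq_bigl => y; rewrite inE.
Qed.

Hypothesis rs : symmetric r.

Lemma cntC A B : cnt A B = cnt B A.
Proof. by rewrite /cnt exchange_big /=; apply: eq_bigr => x _; apply: eq_bigr => y _; rewrite rs. Qed.

Lemma cntUU A B : [disjoint A & B] ->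
  cnt (A :|: B) (A :|: B) = cnt A A + cnt B B + 2 * cnt A B.
Proof. by move=> dAB; rewrite cntUl // !cntUr // (cntC B A); lia. Qed.

(** The only pairs inside the union that lie inside neither set are those between the two
    differences, in both orders. The exact error term later shows that no edge joins the differences
    of two meeting tight sets. *)
Lemma cnt_submod A B :
  cnt (A :|: B) (A :|: B) + cnt (A :&: B) (A :&: B)
  = cnt A A + cnt B B + 2 * cnt (A :\: B) (B :\: A).
Proof.
have dis : [disjoint A :\: B & B].
  by rewrite -setI_eq0; apply/eqP/setP=> x; rewrite !inE; case: (x \in B); rewrite ?andbF.
have -> : A :|: B = (A :\: B) :|: B by apply/setP=> x; rewrite !inE; case: (x \in B); rewrite ?orbT ?orbF.
have eA : cnt A A = cnt (A :&: B) (A :&: B) + cnt (A :\: B) (A :\: B) + 2 * cnt (A :\: B) (A :&: B).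
  by rewrite (cntIDl B A A) !(cntIDr B A) (cntC (A :&: B) (A :\: B)); lia.
by rewrite cntUU // eA (cntIDr A B (A :\: B)) [B :&: A]setIC; lia.
Qed.

Hypothesis ri : irreflexive r.

Lemma cntU1 x A : x \notin A -> cnt (x |: A) (x |: A) = cnt A A + 2 * cnt [set x] A.
Proof. by move=> xA; rewrite cntUU ?disjoints1 // cnt11 ri; lia. Qed.

Lemma cnt_even A : ~~ odd (cnt A A).
Proof.
have [n] := ubnP #|A|; elim: n A => // n IH A lA.
case: (set_0Vmem A) => [->|[x xA]]; first by rewrite cnt0l.
rewrite (cardsD1 x A) xA in lA; have /negbTE H := IH _ lA.
by rewrite -(setD1K xA) cntU1 ?inE ?eqxx // oddD oddM /= addbF H.
Qed.

Lemma cnt_complete A : cnt A A <= #|A| * #|A|.-1.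
Proof.
rewrite {1}/cnt -sum_nat_const; apply: leq_sum => x xA.
rewrite (big_setD1 x xA) /= ri add0n (cardsD1 x A) xA /= -sum1_card.
by apply: leq_sum => y _; case: (r x y).
Qed.

End Count.

Lemma cnt_eq (V : finType) (r1 r2 : rel V) (A B : {set V}) :
  (forall x y, x \in A -> y \in B -> r1 x y = r2 x y) -> cnt r1 A B = cnt r2 A B.
Proof. by move=> H; apply: eq_bigr => x xA; apply: eq_bigr => y yB; rewrite H. Qed.

Lemma cnt_imset (V W : finType) (f : V -> W) (r : rel W) (A B : {set V}) :
  injective f -> cnt r (f @: A) (f @: B) = cnt (relpre f r) A B.
Proof.
move=> fi; rewrite /cnt big_imset /=; last by move=> x y _ _ /fi.
by apply: eq_bigr => x _; rewrite big_imset //= => y z _ _ /fi.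
Qed.

(** * From the graph definitions to edge counts *)

Record z2free (V : finType) (r : rel V) (t : V -> V) : Prop := Z2Free {
  z2_sym : symmetric r;
  z2_irr : irreflexive r;
  z2_inv : involutive t;
  z2_hom : forall x y, r (t x) (t y) = r x y;
  z2_free : forall x, t x != x;
  z2_nofix : forall x, r x (t x) = false }.

Definition sparse_on (V : finType) (r : rel V) (S : {set V}) : Prop :=
  forall U : {set V}, U \subset S -> U != set0 -> cnt r U U + 4 <= 4 * #|U|.

Definition tight (V : finType) (r : rel V) (U : {set V}) : bool :=
  cnt r U U + 4 == 4 * #|U|.

(** Counts are relative to [S], while the symmetry lives on all of [V]: vertices can be deleted
    without changing the ambient type. *)
Definition ci_on (V : finType) (r : rel V) (t : V -> V) (S : {set V}) : Prop :=
  [/\ z2free r t, sparse_on r S & tight r S].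

Definition ci (G : z2graph) : Prop := ci_on (zadj G) (zinv G) setT.

Section Translate.
Variable G : z2graph.
Hypothesis gs : symmetric (zadj G).
Hypothesis gi : irreflexive (zadj G).

Lemma card_zedges_in (S : {set zV G}) :
  cnt (zadj G) S S = 2 * #|[set e in zedges G | e \subset S]|.
Proof.
rewrite cnt_card -sum1_card.
pose h (p : zV G * zV G) := [set p.1; p.2].
(* Ordered pairs are grouped by the edge that they span; each fibre consists of the two orientations
   of one edge. *)
rewrite (partition_big h (mem [set e in zedges G | e \subset S])) /=; last first.
  move=> [x y]; rewrite !inE /= => /and3P[xS yS xy]; apply/andP; split.
    by apply/existsP; exists x; apply/existsP; exists y; rewrite xy eqxx.
  by apply/subsetP => z; rewrite !inE => /orP[]/eqP->.
rewrite mulnC -sum_nat_const; apply: eq_bigr => e.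
rewrite !inE => /andP[/existsP[x /existsP[y /andP[xy /eqP->]]] sS].
have nxy : x != y by apply/eqP=> exy; rewrite exy gi in xy.
have [xS yS] : x \in S /\ y \in S.
  by split; apply: (subsetP sS); rewrite !inE eqxx ?orbT.
rewrite sum1dep_card (_ : 2 = #|[set (x, y); (y, x)]|); last first.
  by rewrite cards2 xpair_eqE negb_and nxy.
apply: eq_card => [[a b]]; rewrite !inE /h /= !xpair_eqE; apply/idP/idP.
  case/andP=> /and3P[aS bS ab] /eqP E.
  have nab : a != b by apply/eqP=> exy; rewrite exy gi in ab.
  have := set21 a b; have := set22 a b; rewrite E !inE.
  by do 2!(case/orP=> /eqP ?; subst); rewrite ?eqxx ?orbT // in nab *.
case/orP=> /andP[/eqP-> /eqP->]; rewrite xS yS /=; first by rewrite xy eqxx.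
by rewrite gs xy setUC eqxx.
Qed.

(** For a given vertex set the induced edge set is the largest admissible [F], so testing vertex
    sets is enough. *)
Lemma sparse22P : sparse22 G <-> sparse_on (zadj G) setT.
Proof.
split=> [H U _ U0|H S F S0 FE FS].
  have := H U [set e in zedges G | e \subset U] U0.
  rewrite card_zedges_in => H1; have : #|[set e in zedges G | e \subset U]| + 2 <= 2 * #|U|; last by lia.
  apply: H1.
  - by apply/subsetP=> e; rewrite inE => /andP[].
  - by move=> e; rewrite inE => /andP[].
have := H S (subsetT _) S0; rewrite card_zedges_in.
have : #|F| <= #|[set e in zedges G | e \subset S]|.
  by apply/subset_leq_card/subsetP => e eF; rewrite inE (subsetP FE) // FS.
by lia.
Qed.

Lemma tight22P :
  tight (zadj G) setT <-> #|zedges G| + 2 = 2 * #|[set: zV G]|.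
Proof.
rewrite /tight card_zedges_in.
rewrite (_ : [set _ in _ | _] = zedges G); last by apply/setP=> e; rewrite inE subsetT andbT.
by split=> [/eqP|]; [|move=> ?; apply/eqP]; lia.
Qed.

End Translate.

(** When no vertex is fixed, a fixed edge has its ends exchanged. Hence fixing no edge amounts to
    never joining a vertex to its image, the form used in [z2free]. *)
Lemma ciP (G : z2graph) : ci G <-> z2_wf G /\ ci_tight G.
Proof.
split=> [[[gs gi tt th tf tn] sp ti]|[[gs gi tt th] [[sp ti] tf tn]]].
  split; first by split=> // x; rewrite gi.
  split=> //; first by split; [apply/sparse22P | apply/tight22P].
  move=> x y xy; apply/eqP => E.
  have := set21 (zinv G x) (zinv G y); rewrite E !inE (negbTE (tf x)) /= => /eqP e.
  by move: (tn x); rewrite e xy.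
have gi' : irreflexive (zadj G) by move=> x; apply: negbTE.
split; [split=> // x | by apply/sparse22P | by apply/tight22P].
apply/negP => xy; move: (tn _ _ xy); rewrite tt setUC eqxx //.
Qed.

Lemma ci_iso (G H : z2graph) : z2iso G H -> ci G -> ci H.
Proof.
move=> [f [fb fa fi]] [[gs gi tt th tf tn] sp ti].
have [g gK fK] := fb; have finj := bij_inj fb.
have cH (U : {set zV G}) : cnt (zadj H) (f @: U) (f @: U) = cnt (zadj G) U U.
  by rewrite cnt_imset //; apply: cnt_eq => x y _ _ /=; rewrite fa.
have im (U : {set zV H}) : U = f @: (f @^-1: U).
  apply/setP=> x; apply/idP/imsetP => [xU|[y]]; last by rewrite inE => yU ->.
  by exists (g x); rewrite ?inE ?fK.
split.
- split.
  + by move=> x y; rewrite -(fK x) -(fK y) !fa gs.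
  + by move=> x; rewrite -(fK x) fa gi.
  + by move=> x; rewrite -(fK x) -!fi tt.
  + by move=> x y; rewrite -(fK x) -(fK y) -!fi !fa th.
  + by move=> x; rewrite -(fK x) -fi (inj_eq finj).
  + by move=> x; rewrite -(fK x) -fi fa tn.
- move=> U _ U0; rewrite (im U) cH card_imset //; apply: sp; rewrite ?subsetT //.
  by apply: contra U0 => /eqP e; rewrite (im U) e imset0.
- have iT : setT = f @: setT.
    by apply/setP=> x; rewrite inE; apply/esym/imsetP; exists (g x); rewrite ?fK.
  by rewrite /tight iT cH card_imset.
Qed.

Lemma cntD (V : finType) (r r1 r2 : rel V) (A B : {set V}) :
  (forall x y, x \in A -> y \in B -> r x y = r1 x y + r2 x y :> nat) ->
  cnt r A B = cnt r1 A B + cnt r2 A B.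
Proof.
move=> H; rewrite -big_split /=; apply: eq_bigr => x xA; rewrite -big_split /=.
by apply: eq_bigr => y yB; rewrite H.
Qed.

Lemma cnt_same_pair (V : finType) (a b : V) (A : {set V}) : a != b ->
  cnt (fun x y => same_pair x y a b) A A = 2 * ((a \in A) && (b \in A)).
Proof.
move=> nab; rewrite cnt_card.
case: (boolP (a \in A)) => /= aA; last first.
  apply/eqP; rewrite muln0 cards_eq0; apply/eqP/setP=> [[x y]]; rewrite !inE /= /same_pair.
  apply/negP=> /and3P[xA yA /orP[]/andP[/eqP ? /eqP ?]]; subst; by rewrite ?xA ?yA in aA.
case: (boolP (b \in A)) => /= bA; last first.
  apply/eqP; rewrite muln0 cards_eq0; apply/eqP/setP=> [[x y]]; rewrite !inE /= /same_pair.
  apply/negP=> /and3P[xA yA /orP[]/andP[/eqP ? /eqP ?]]; subst; by rewrite ?xA ?yA in bA.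
rewrite muln1 (_ : 2 = #|[set (a, b); (b, a)]|); last first.
  by rewrite cards2 xpair_eqE negb_and nab.
apply: eq_card => [[x y]]; rewrite !inE /= /same_pair !xpair_eqE.
apply/idP/idP => [/and3P[_ _]|]; rewrite //.
by case/orP=> /andP[/eqP-> /eqP->]; rewrite aA bA !eqxx /= ?orbT.
Qed.

Lemma same_pair_sym (T : eqType) (x y a b : T) : same_pair x y a b = same_pair y x a b.
Proof. by rewrite /same_pair orbC ![(x == _) && _]andbC. Qed.

Lemma same_pair_inv (T : eqType) (t : T -> T) (x y a b : T) : involutive t ->
  same_pair (t x) (t y) (t a) (t b) = same_pair x y a b.
Proof. by move=> /inv_inj ti; rewrite /same_pair !(inj_eq ti). Qed.

Lemma sum_pred (V : finType) (A : {set V}) (s : seq V) (f : pred V) : uniq s -> f =1 mem s ->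
  \sum_(x in A) f x = \sum_(y <- s) (y \in A).
Proof.
move=> us fs; rewrite [RHS]big_uniq //= [LHS]big_mkcond [RHS]big_mkcond /=.
by apply: eq_bigr => x _; rewrite fs /=; case: (x \in A); case: (x \in s).
Qed.

Lemma sum_sumT (V N : finType) (S : {set V + N}) (F : V + N -> nat) :
  \sum_(p in S) F p = \sum_(x in inl @^-1: S) F (inl x) + \sum_(n in inr @^-1: S) F (inr n).
Proof.
rewrite big_sumType /=; congr (_ + _); apply: eq_bigl => x; rewrite inE //.
Qed.

Lemma card_sumT (V N : finType) (S : {set V + N}) :
  #|S| = #|inl @^-1: S| + #|inr @^-1: S|.
Proof. by rewrite -!sum1_card sum_sumT. Qed.

Lemma sum_bool (S : {set bool}) (F : bool -> nat) :
  \sum_(b in S) F b = (true \in S) * F true + (false \in S) * F false.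
Proof.
by rewrite big_mkcond big_bool /=; case: (true \in S); case: (false \in S); rewrite ?mul1n.
Qed.

(** * The operations preserve tightness *)

Section AddPair.
Variables (V : finType) (r : rel (V + bool)) (S : {set V + bool}).
Hypothesis rs : symmetric r.
Hypothesis rN : forall b c, r (inr b) (inr c) = false.

(** The two new vertices are not adjacent, so each of them contributes only its edges to the old
    part of [S]. *)
Lemma cnt_addpair :
  cnt r S S = cnt (relpre inl r) (inl @^-1: S) (inl @^-1: S)
  + 2 * (inr true \in S) * \sum_(x in inl @^-1: S) r (inr true) (inl x)
  + 2 * (inr false \in S) * \sum_(x in inl @^-1: S) r (inr false) (inl x).
Proof.
rewrite /cnt sum_sumT sum_bool !inE !sum_sumT !sum_bool !rN !muln0 !addn0.
under eq_bigr => x _ do rewrite sum_sumT sum_bool !inE (rs (inl x) (inr true)) (rs (inl x) (inr false)).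
rewrite !big_split /= -!big_distrr /=.
by case: (inr true \in S); case: (inr false \in S); rewrite ?mul0n ?mul1n ?muln0 ?muln1; lia.
Qed.

Lemma card_addpair :
  #|S| = #|inl @^-1: S| + (inr true \in S) + (inr false \in S).
Proof. by rewrite card_sumT -[#|inr @^-1: S|]sum1_card sum_bool !inE !muln1 addnA. Qed.

End AddPair.

Lemma sym_rel_sym (T : Type) (r : rel T) : symmetric (sym_rel r).
Proof. by move=> x y; rewrite /sym_rel orbC. Qed.

Lemma swapb_inv (T : Type) (t : T -> T) : involutive t -> involutive (swapb t).
Proof. by move=> ti [x|b] /=; rewrite ?ti ?negbK. Qed.

Lemma swapb_free (T : eqType) (t : T -> T) : (forall x, t x != x) ->
  forall p : T + bool, swapb t p != p.
Proof. by move=> tf [x|[]] //=; apply/eqP => -[] /eqP; rewrite (negbTE (tf x)). Qed.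

Lemma inv_eqC (T : eqType) (t : T -> T) x y : involutive t -> (t x == y) = (x == t y).
Proof. by move=> ti; rewrite -{1}(ti y) (inj_eq (inv_inj ti)). Qed.

Lemma ci_ext0 (G : z2graph) (a b : zV G) : ci G -> a != b -> ci (ext0 a b).
Proof.
move=> [[gs gi tt th tf tn] sp ti] nab.
have eqt := inj_eq (inv_inj tt).
have tn1 x : zadj G (zinv G x) x = false by rewrite gs.
have nab' : zinv G a != zinv G b by rewrite eqt.
have E (S : {set zV G}) :
    \sum_(x in S) zadj (ext0 a b) (inr true) (inl x) = (a \in S) + (b \in S).
  rewrite (@sum_pred _ _ [:: a; b]) /= ?big_cons ?big_nil ?addn0 ?mem_seq1 ?nab //.
  by move=> x; rewrite /= /sym_rel /= orbF mem_seq2.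
have E' (S : {set zV G}) :
    \sum_(x in S) zadj (ext0 a b) (inr false) (inl x) = (zinv G a \in S) + (zinv G b \in S).
  rewrite (@sum_pred _ _ [:: zinv G a; zinv G b]) /= ?big_cons ?big_nil ?addn0 ?mem_seq1 ?nab' //.
  by move=> x; rewrite /= /sym_rel /= orbF mem_seq2.
split.
- split.
  + exact: sym_rel_sym.
  + by move=> [x|[]] //=; rewrite /sym_rel /= gi.
  + exact: swapb_inv.
  + move=> [x|[]] [y|[]]; rewrite /= /sym_rel /= ?th ?orbF ?eqt //.
      by rewrite !(inv_eqC _ _ tt).
    by rewrite !(inv_eqC _ _ tt).
  + exact: swapb_free.
  + by move=> [x|[]]; rewrite /= /sym_rel /= ?tn ?tn1.
- move=> S _ S0.
  have := S0; rewrite -card_gt0.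
  rewrite cnt_addpair ?card_addpair; [|exact: sym_rel_sym|by case; case].
  set U := inl @^-1: S.
  rewrite (@cnt_eq _ _ (zadj G) U); last by move=> x y _ _; rewrite /= /sym_rel /= gs orbb.
  rewrite E E'.
  have [U0|U0] := eqVneq U set0.
    by rewrite U0 cnt0l !inE cards0; lia.
  have := sp U (subsetT _) U0.
  (* A new vertex in [S] brings at most two edges, that is 4 ordered pairs, and raises [4 * #|S|] by
     4. *)
  have K (e f g : bool) : 2 * e * (f + g) <= 4 * e by case: e f g => [] [] [].
  have := K (inr true \in S) (a \in U) (b \in U).
  have := K (inr false \in S) (zinv G a \in U) (zinv G b \in U).
  move: (2 * _ * _) (2 * _ * _) => X Y.
  move: (nat_of_bool (inr true \in S)) (nat_of_bool (inr false \in S)) #|U| (cnt _ _ _).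
  by clear; lia.
- rewrite /tight cnt_addpair ?card_addpair; [|exact: sym_rel_sym|by case; case].
  set U := inl @^-1: _; have -> : U = setT by apply/setP => x; rewrite !inE.
  rewrite (@cnt_eq _ _ (zadj G)); last by move=> x y _ _; rewrite /= /sym_rel /= gs orbb.
  by rewrite E E' !inE; move: ti; rewrite /tight; lia.
Qed.

(** A new vertex sends three edges into an old set [U] only when both ends of the corresponding
    deleted edge lie in [U]; the deletion then pays for the third edge. *)
Lemma ci_ext1 (G : z2graph) (a b c : zV G) : ci G -> zadj G a b -> c != a -> c != b ->
  ci (ext1 a b c).
Proof.
move=> [[gs gi tt th tf tn] sp ti] rab nca ncb.
have eqt := inj_eq (inv_inj tt).
have tn1 x : zadj G (zinv G x) x = false by rewrite gs.
have nab : a != b by apply/eqP=> e; rewrite e gi in rab.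
have nab' : zinv G a != zinv G b by rewrite eqt.
have E (S : {set zV G}) : \sum_(x in S) zadj (ext1 a b c) (inr true) (inl x) =
    (a \in S) + (b \in S) + (c \in S).
  rewrite (@sum_pred _ _ [:: a; b; c]) /= ?big_cons ?big_nil ?addn0 ?addnA //.
    by rewrite mem_seq2 mem_seq1 negb_or nab ![_ == c]eq_sym nca ncb.
  by move=> x; rewrite /= /sym_rel /= orbF mem_seq3.
have E' (S : {set zV G}) : \sum_(x in S) zadj (ext1 a b c) (inr false) (inl x) =
    (zinv G a \in S) + (zinv G b \in S) + (zinv G c \in S).
  rewrite (@sum_pred _ _ [:: zinv G a; zinv G b; zinv G c]) /= ?big_cons ?big_nil ?addn0 ?addnA //.
    by rewrite mem_seq2 mem_seq1 negb_or !eqt nab ![_ == c]eq_sym nca ncb.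
  by move=> x; rewrite /= /sym_rel /= orbF mem_seq3.
(* The two deleted edges are distinct, since otherwise a vertex would be fixed or joined to its
   image. They may therefore be counted separately. *)
have disj x y : same_pair x y a b -> same_pair x y (zinv G a) (zinv G b) = false.
  case/orP=> /andP[/eqP-> /eqP->]; apply/negP=> /orP[]/andP[/eqP e1 /eqP e2].
  + by move: (tf a); rewrite -e1 eqxx.
  + by move: (tn a); rewrite -e2 rab.
  + by move: (tn b); rewrite -e2 gs rab.
  + by move: (tf b); rewrite -e1 eqxx.
have sadj x y : same_pair x y a b -> zadj G x y.
  by case/orP=> /andP[/eqP-> /eqP->]; rewrite // gs.
have sadj' x y : same_pair x y (zinv G a) (zinv G b) -> zadj G x y.
  by case/orP=> /andP[/eqP-> /eqP->]; rewrite // th // gs.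
have C (S : {set zV G}) : cnt (zadj G) S S = cnt (relpre inl (zadj (ext1 a b c))) S S +
   (2 * ((a \in S) && (b \in S)) + 2 * ((zinv G a \in S) && (zinv G b \in S))).
  rewrite -!cnt_same_pair // -(@cntD _ (fun x y => same_pair x y a b || same_pair x y (zinv G a) (zinv G b))).
    apply: cntD => x y _ _; rewrite /= /sym_rel /= [zadj G y x]gs ![same_pair y x _ _]same_pair_sym orbb.
    case: (boolP (same_pair x y a b)) => [/sadj ->|_] //=.
    by case: (boolP (same_pair x y (zinv G a) (zinv G b))) => [/sadj' ->|_] //=; rewrite !andbT addn0.
  by move=> x y _ _; case: (boolP (same_pair x y a b)) => [/disj ->|_].
split.
- split.
  + exact: sym_rel_sym.
  + by move=> [x|[]] //=; rewrite /sym_rel /= gi.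
  + exact: swapb_inv.
  + move=> [x|[]] [y|[]]; rewrite /= /sym_rel /= ?th ?orbF ?eqt // ?(inv_eqC _ _ tt) //.
    rewrite !(same_pair_inv _ _ _ _ tt).
    have sw u v : same_pair (zinv G u) (zinv G v) a b = same_pair u v (zinv G a) (zinv G b).
      by rewrite -(same_pair_inv _ _ _ _ tt) !tt.
    by rewrite !sw [in LHS]andbC; do !case: same_pair; rewrite ?andbF ?andbT.
  + exact: swapb_free.
  + by move=> [x|[]]; rewrite /= /sym_rel /= ?tn ?tn1.
- move=> S _ S0.
  have := S0; rewrite -card_gt0.
  rewrite cnt_addpair ?card_addpair; [|exact: sym_rel_sym|by case; case].
  set U := inl @^-1: S; have := C U; rewrite E E'.
  have [U0|U0] := eqVneq U set0.
    rewrite U0 !cnt0l !inE cards0.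
    by move: (nat_of_bool (inr true \in S)) (nat_of_bool (inr false \in S)); clear; lia.
  have := sp U (subsetT _) U0.
  have K (e f g h : bool) : 2 * e * (f + g + h) <= 2 * (f && g) + 4 * e.
    by case: e f g h => [] [] [] [].
  have := K (inr true \in S) (a \in U) (b \in U) (c \in U).
  have := K (inr false \in S) (zinv G a \in U) (zinv G b \in U) (zinv G c \in U).
  move: (2 * _ * _) (2 * _ * _) (nat_of_bool ((a \in U) && _)) (nat_of_bool ((zinv G a \in U) && _)) => X Y p q.
  move: (nat_of_bool (inr true \in S)) (nat_of_bool (inr false \in S)) #|U| (cnt _ _ _) (cnt _ _ _) => e f n m k.
  by clear; lia.
- rewrite /tight cnt_addpair ?card_addpair; [|exact: sym_rel_sym|by case; case].
  set U := inl @^-1: _; have -> : U = setT by apply/setP => x; rewrite !inE.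
  have := C setT; rewrite E E' !inE /=; move: ti; rewrite /tight.
  by lia.
Qed.

(** * Vertex-to-K4 and vertex-to-C4 operations *)

Ltac cnt_lia := clear; repeat match goal with
  | |- context [cnt ?r ?A ?B] => move: (cnt r A B) => ?
  | |- context [#|?A|] => move: #|A| => ?
  end; lia.

Lemma disjointI (T : finType) (A B : {set T}) :
  (forall x, x \in A -> x \in B -> False) -> [disjoint A & B].
Proof.
by move=> H; rewrite disjoint_subset; apply/subsetP=> x xA; rewrite inE; apply/negP => /(H _ xA).
Qed.

(* Common core of vertex-to-K4 and vertex-to-C4: w is replaced by a set F of vertices, and
   t w by its image.  Any nonempty part A of F may carry at most 2(|A| - 1) edges more,
   towards itself and the rest B, than w carries towards B. *)
Section Split.
Variables (V N : finType) (r : rel V) (t : V -> V) (w : V).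
Variables (rH : rel (V + N)) (tH : V + N -> V + N) (F : {set V + N}).
Hypothesis ciG : ci_on r t setT.
Hypothesis zH : z2free rH tH.
Hypothesis tHl : forall x, tH (inl x) = inl (t x).
Hypothesis FE : forall p, (p \in F) || (p \in tH @: F) =
  if p is inl x then (x == w) || (x == t w) else true.
Hypothesis dF : [disjoint F & tH @: F].
Hypothesis rHl : forall x y, x \notin [set w; t w] -> y \notin [set w; t w] ->
  rH (inl x) (inl y) = r x y.
Hypothesis rHF : forall p q, p \in F -> q \in tH @: F -> rH p q = false.
Hypothesis fibre : forall (A : {set V + N}) (B : {set V}),
  A \subset F -> A != set0 -> [disjoint B & [set w; t w]] ->
  cnt rH A A + 2 * cnt rH A (inl @: B) + 4 <= 2 * cnt r [set w] B + 4 * #|A|.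
Hypothesis fibre_full : let B := ~: [set w; t w] in
  cnt rH F F + 2 * cnt rH F (inl @: B) + 4 = 2 * cnt r [set w] B + 4 * #|F|.

Let inl_inj : injective (@inl V N).
Proof. by move=> x y []. Qed.

Let cnt_t (A B : {set V + N}) : cnt rH (tH @: A) (tH @: B) = cnt rH A B.
Proof.
rewrite cnt_imset; first by apply: cnt_eq => x y _ _ /=; apply: z2_hom zH _ _.
exact/inv_inj/(z2_inv zH).
Qed.

Let cnt_w (B : {set V}) : cnt r [set t w] (t @: B) = cnt r [set w] B.
Proof.
have [[gs gi tt th tf tn] sp ti] := ciG.
rewrite -imset_set1 cnt_imset; last exact: inv_inj.
by apply: cnt_eq => x y _ _; apply: th.
Qed.

Let tHinl (B : {set V}) : tH @: (inl @: B) = inl @: (t @: B).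
Proof. by rewrite -!imset_comp; apply: eq_imset => x /=; rewrite tHl. Qed.

Let ttB (B : {set V}) : t @: (t @: B) = B.
Proof.
have [[gs gi tt th tf tn] sp ti] := ciG.
by rewrite -imset_comp -[RHS]imset_id; apply: eq_imset => x /=; rewrite tt.
Qed.

Let ttA (A : {set V + N}) : tH @: (tH @: A) = A.
Proof. by rewrite -imset_comp -[RHS]imset_id; apply: eq_imset => x /=; rewrite (z2_inv zH). Qed.

Let card_t (A : {set V + N}) : #|tH @: A| = #|A|.
Proof. by rewrite card_imset //; exact/inv_inj/(z2_inv zH). Qed.

Let disj_t (B : {set V}) : [disjoint B & [set w; t w]] -> [disjoint t @: B & [set w; t w]].
Proof.
have [[gs gi tt th tf tn] sp ti] := ciG.
move=> /disjoint_setI0/setP dB; apply: disjointI => _ /imsetP[x xB ->].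
have := dB x; rewrite !inE xB /= !(inv_eqC _ _ tt) tt => /negbT.
by rewrite orbC => /negbTE ->.
Qed.

Let fibre' (A : {set V + N}) (B : {set V}) :
  A \subset tH @: F -> A != set0 -> [disjoint B & [set w; t w]] ->
  cnt rH A A + 2 * cnt rH A (inl @: B) + 4 <= 2 * cnt r [set t w] B + 4 * #|A|.
Proof.
move=> sA A0 dB.
have := @fibre (tH @: A) (t @: B); rewrite -cnt_w ttB -tHinl !cnt_t card_t.
apply.
- by rewrite -(ttA F) imsetS.
- by rewrite -(ttA A) -card_gt0 card_t card_gt0 ttA in A0 *.
- exact: disj_t.
Qed.

Let decomp (B : {set V}) (A A' : {set V + N}) (S := inl @: B :|: (A :|: A')) :
  A \subset F -> A' \subset tH @: F -> [disjoint B & [set w; t w]] ->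
  cnt rH S S = cnt r B B + (cnt rH A A + 2 * cnt rH A (inl @: B))
    + (cnt rH A' A' + 2 * cnt rH A' (inl @: B)) /\ #|S| = #|B| + #|A| + #|A'|.
Proof.
move=> sA sA' /disjoint_setI0/setP dB.
have dAA' : [disjoint A & A'].
  apply: disjointWl sA _; exact: disjointWr sA' dF.
have dBA : [disjoint inl @: B & A :|: A'].
  apply: disjointI => _ /imsetP[x xB ->] xA.
  have := FE (inl x); have := dB x; rewrite !inE xB /= => ->.
  by case/setUP: xA => [/(subsetP sA)|/(subsetP sA')] ->; rewrite ?orbT.
have zs := z2_sym zH.
split; last by rewrite !cardsU !disjoint_setI0 // !cards0 !subn0 card_imset // addnA.
rewrite !cntUU // cnt_imset //.
rewrite (@cnt_eq _ (relpre inl rH) r B B); last first.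
  have nB x : x \in B -> x \notin [set w; t w].
    by move=> xB; have := dB x; rewrite !inE xB /= => ->.
  by move=> x y /nB xB /nB yB /=; apply: rHl.
rewrite (@cnt_0 _ rH A A'); last first.
  by move=> p q pA qA'; apply: rHF; [apply: (subsetP sA) | apply: (subsetP sA')].
by rewrite (cntC zs (inl @: B)) cntUl //; lia.
Qed.

(** A set [S] is cut into its part [B] away from [w] and [t w], and its parts in [F] and in the
    image of [F]. Replacing each nonempty part by [w] or [t w] gives a set of the old graph, and
    [fibre] compares the two counts; [fibre_full] gives equality for the whole vertex set. *)
Lemma ci_split : ci_on rH tH setT.
Proof.
have [[gs gi tt th tf tn] sp ti] := ciG.
split=> //.
- move=> S _ S0.
  pose B := inl @^-1: S :\: [set w; t w].
  have dB : [disjoint B & [set w; t w]].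
    by apply: disjointI => x; rewrite !inE => /andP[/negP n _].
  have ES : S = inl @: B :|: (S :&: F :|: S :&: tH @: F).
    apply/setP=> p; rewrite -setIUr !in_setU in_setI in_setU FE.
    case: p => [x|n]; last first.
      by rewrite andbT orbC orb_idr // => /imsetP[].
    rewrite (mem_imset _ _ inl_inj) !inE.
    by case: (inl x \in S); rewrite ?andbF //= andbT orNb.
  have [E1 E2] := decomp (subsetIr S F) (subsetIr S (tH @: F)) dB.
  rewrite -ES in E1 E2; rewrite E1 E2.
  have HA := fibre (subsetIr S F) _ dB.
  have HA' := fibre' (subsetIr S (tH @: F)) _ dB.
  have wB : w \notin B by rewrite !inE eqxx.
  have wB' : t w \notin B by rewrite !inE eqxx orbT.
  have wB2 : w \notin t w |: B by rewrite !inE eqxx /= orbF eq_sym tf.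
  have E0 : cnt r [set w] [set t w] = 0 by rewrite cnt11 tn.
  have spB := sp B (subsetT _); have spwB := sp (w |: B) (subsetT _).
  have spwB' := sp (t w |: B) (subsetT _); have spww := sp (w |: (t w |: B)) (subsetT _).
  have ne x (C : {set V}) : x |: C != set0 by apply/set0Pn; exists x; rewrite setU11.
  move: spwB (ne w B) spwB' (ne (t w) B) spww (ne w (t w |: B)).
  rewrite !(cntU1 gs gi) // !cardsU1 wB wB' wB2 /= => spwB /spwB {}spwB spwB' /spwB' {}spwB' spww.
  move=> /spww {}spww; rewrite cntUr ?E0 in spww; last by rewrite disjoints1.
  (* The four cases use sparsity of [B], [t w |: B], [w |: B] and [w |: (t w |: B)] respectively. *)
  have [A0|A0] := eqVneq (S :&: F) set0; have [A0'|A0'] := eqVneq (S :&: tH @: F) set0.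
  + have B0 : B != set0.
      by apply: contra S0 => /eqP B0; rewrite ES B0 A0 A0' imset0 !setU0.
    by rewrite A0 A0' !cnt0l cards0; move: (spB B0); cnt_lia.
  + by rewrite A0 !cnt0l cards0; move: (HA' A0') spwB'; cnt_lia.
  + by rewrite A0' !cnt0l cards0; move: (HA A0) spwB; cnt_lia.
  + by move: (HA A0) (HA' A0') spww; cnt_lia.
- pose B := ~: [set w; t w].
  have dB : [disjoint B & [set w; t w]] by apply: disjointI => x; rewrite inE => /negP.
  have ES : setT = inl @: B :|: (F :|: tH @: F).
    apply/setP=> p; rewrite in_setT !in_setU FE.
    case: p => [x|n]; last by rewrite orbT.
    by rewrite (mem_imset _ _ inl_inj) !inE orNb.
  have [E1 E2] := decomp (subxx F) (subxx (tH @: F)) dB.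
  rewrite -ES in E1 E2; rewrite /tight E1 E2.
  have wB : w \notin B by rewrite !inE eqxx.
  have wB' : t w \notin B by rewrite !inE eqxx orbT.
  have wB2 : w \notin t w |: B by rewrite !inE eqxx /= orbF eq_sym tf.
  have tB : t @: B = B.
    apply/setP=> x; rewrite -{1}(tt x) mem_imset ?inE; last exact: inv_inj.
    by rewrite !(inv_eqC _ _ tt) tt orbC.
  have := fibre_full; rewrite /= -/B => f1.
  have f2 : cnt rH (tH @: F) (tH @: F) + 2 * cnt rH (tH @: F) (inl @: B) + 4 =
     2 * cnt r [set t w] B + 4 * #|tH @: F|.
    by rewrite -tB -tHinl !cnt_t card_t cnt_w.
  have VE : setT = w |: (t w |: B).
    by apply/setP=> x; rewrite !inE orbA orbN.
  move: ti; rewrite /tight [in X in X -> _]VE !(cntU1 gs gi) // cntUr ?disjoints1 // cnt11 tn.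
  by rewrite !cardsU1 wB' wB2 /=; move: f1 f2; cnt_lia.
Qed.

End Split.

Lemma cnt_clique (V : finType) (r : rel V) (A : {set V}) :
  (forall x y, x \in A -> y \in A -> r x y = (x != y)) -> cnt r A A = #|A| * #|A|.-1.
Proof.
move=> H; rewrite /cnt -sum_nat_const; apply: eq_bigr => x xA.
rewrite (big_setD1 x xA) /= H // eqxx add0n (cardsD1 x A) xA /= -sum1_card.
by apply: eq_bigr => y; rewrite !inE eq_sym => /andP[yx yA]; rewrite H // yx.
Qed.

Lemma and5_swap a b c d e : [&& a, b, c, d & e] = [&& a, d, e, b & c].
Proof. by case: a b c d e => [] [] [] [] []. Qed.

Section K4.
Variables (G : z2graph) (w : zV G) (d : zV G -> option 'I_3).
Hypothesis ciG : ci G.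
Let r := zadj G.
Let t := zinv G.
Let H := vertex_to_K4 w d.
Let F : {set zV H} := [set p : zV G + bool * 'I_3 | match p with inl x => x == w | inr (b, _) => b end].

Lemma K4_z2free : z2free (zadj H) (zinv H).
Proof.
have [[gs gi tt th tf tn] _ _] := ciG.
have tn1 x : zadj G (zinv G x) x = false by rewrite gs.
have sw x : zadj G w (zinv G x) = zadj G (zinv G w) x by rewrite -th tt.
split.
- exact: sym_rel_sym.
- by move=> [x|[[] i]]; rewrite /= /sym_rel /= ?gi ?eqxx.
- by move=> [x|[b i]] /=; rewrite ?tt ?negbK.
- move=> [x|[b i]] [y|[c j]]; rewrite /= /sym_rel /=.
  + rewrite !th !(inv_eqC _ _ tt) !tt.
    by congr (_ || _); rewrite and5_swap.
  + by case: c; rewrite /= !(inv_eqC _ _ tt) ?tt // ?th ?sw.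
  + by case: b; rewrite /= !(inv_eqC _ _ tt) ?tt // ?th ?sw.
  + by case: b; case: c.
- by move=> [x|[[] i]] //=; apply/eqP => -[] // /eqP; rewrite (negbTE (tf x)).
- by move=> [x|[[] i]]; rewrite /= /sym_rel /= ?tn ?tn1.
Qed.

Let FE' : zinv H @: F = [set p : zV G + bool * 'I_3 |
   match p with inl x => x == t w | inr (b, _) => ~~ b end].
Proof.
have tH := z2_inv K4_z2free.
have [[gs gi tt th tf tn] _ _] := ciG.
apply/setP => p; rewrite -{1}(tH p) mem_imset; last exact: inv_inj.
by case: p => [x|[b i]]; rewrite !inE //= inv_eqC.
Qed.

(* The end in F of the edge that replaces w x. *)
Let ell (x : zV G) : zV H := if d x is Some i then inr (true, i) else inl w.

Let adjF p x : p \in F -> x \notin [set w; t w] -> zadj H p (inl x) = r w x && (p == ell x).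
Proof.
have [[gs gi tt th tf tn] _ _] := ciG.
rewrite /ell !inE negb_or => pF /andP[xw xw'].
case: p pF => [y /eqP ->|[b i] -> /=]; rewrite /= /sym_rel /=.
  rewrite !eqxx (negbTE xw) (negbTE xw') ![w == zinv G w]eq_sym (negbTE (tf w)) /= ![zadj G x w]gs.
  by case: (d x) => [i|]; rewrite ?eqxx ?andbF ?andbT ?orbb.
rewrite (negbTE xw) /= orbF /r; congr (_ && _).
by case: (d x) => [j|] //=; apply/eqP/eqP => [[->]|[->]].
Qed.

(** Each outer neighbour [x] of [w] has exactly one neighbour in [F], namely [ell x]. *)
Let cntF (B : {set zV G}) : [disjoint B & [set w; t w]] -> cnt (zadj H) F (inl @: B) = cnt r [set w] B.
Proof.
move=> dB.
have inji : injective (@inl (zV G) (bool * 'I_3)) by move=> x y [].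
rewrite cntC; last exact: sym_rel_sym.
rewrite cnt1l /cnt big_imset /=; last by move=> x y _ _ /inji.
apply: eq_bigr => x xB.
have xn : x \notin [set w; t w] by rewrite (disjointFr dB).
have eF : ell x \in F by rewrite /ell inE; case: (d x).
rewrite (big_setD1 (ell x) eF) /= [sym_rel _ _ _](_ : _ = zadj H (ell x) (inl x)); last exact: sym_rel_sym.
rewrite adjF // eqxx andbT big1 ?addn0 // => p; rewrite in_setD1 => /andP[pe pF].
rewrite [sym_rel _ _ _](_ : _ = zadj H p (inl x)); last exact: sym_rel_sym.
by rewrite adjF // (negbTE pe) andbF.
Qed.

Let cardF : #|F| = 4.
Proof.
rewrite card_sumT (_ : inl @^-1: F = [set w]); last by apply/setP=> x; rewrite !inE.
rewrite (_ : inr @^-1: F = setX [set true] setT); last first.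
  by apply/setP=> [[b i]]; rewrite !inE andbT; case: b.
by rewrite cardsX !cards1 cardsT card_ord.
Qed.

(** A part of the clique with a vertices spans at most a(a-1) ordered pairs, and a(a-1) + 4 <= 4a
    holds for a from 1 to 4, with equality at a = 4. *)
Lemma ci_K4 : ci H.
Proof.
have [[gs gi tt th tf tn] _ _] := ciG.
have tn1 x : zadj G (zinv G x) x = false by rewrite gs.
apply: (@ci_split _ _ r t w (zadj H) (zinv H) F ciG).
- exact: K4_z2free.
- by [].
- by move=> p; rewrite FE' !inE; case: p => // -[[] i].
- apply: disjointI => p; rewrite FE' !inE; case: p => [x /eqP ->|[[] i]] //.
  by rewrite eq_sym (negbTE (tf w)).
- move=> x y; rewrite !inE !negb_or => /andP[/negbTE xw /negbTE xw'] /andP[/negbTE yw /negbTE yw'].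
  by rewrite /= /sym_rel /= xw xw' yw yw' /= !andbT [zadj G y x]gs orbb.
- move=> p q; rewrite FE' !inE; case: p => [x /eqP->|[b i] ->]; case: q => [y /eqP->|[c j] /negbTE->].
  + by rewrite /= /sym_rel /= tn tn1.
  + by rewrite /= /sym_rel /= tn1 eq_sym (negbTE (tf w)).
  + by rewrite /= /sym_rel /= tn (negbTE (tf w)).
  + by [].
- move=> A B sA A0 dB.
  have h1 := cnt_complete (z2_irr K4_z2free) A.
  have h2 := cnt_subl (zadj H) (inl @: B) sA; rewrite cntF // in h2.
  have h3 := subset_leq_card sA; rewrite cardF in h3; rewrite -card_gt0 in A0.
  move: A0 h1 h2 h3; rewrite /r -/H.
  case: #|A| => [|[|[|[|[|m]]]]] // _; cnt_lia.
- set B := ~: _; rewrite /= cntF; last by apply: disjointI => x; rewrite inE => /negP.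
  rewrite (@cnt_clique _ _ F) ?cardF; first by cnt_lia.
  move=> p q; rewrite !inE; case: p => [x /eqP->|[b i] ->]; case: q => [y /eqP->|[c j] ->].
  + by rewrite /= /sym_rel /= gi /=; apply/esym/negP => n; apply: n; apply/eqP.
  + by rewrite /= /sym_rel /= eqxx ?orbT; apply/esym/eqP.
  + by rewrite /= /sym_rel /= eqxx ?orbT; apply/esym/eqP.
  + by rewrite /= /sym_rel /= [j == i]eq_sym orbb.
Qed.

End K4.

Section C4.
Variables (G : z2graph) (w v1 v2 : zV G) (M : pred (zV G)).
Hypothesis ciG : ci G.
Hypothesis v12 : v1 != v2.
Hypothesis wv1 : zadj G w v1.
Hypothesis wv2 : zadj G w v2.
Let r := zadj G.
Let t := zinv G.
Let H := vertex_to_C4 w v1 v2 M.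
Let F : {set zV H} := [set p : zV G + bool | match p with inl x => x == w | inr b => b end].

Lemma C4_z2free : z2free (zadj H) (zinv H).
Proof.
have [[gs gi tt th tf tn] _ _] := ciG.
have tn1 x : zadj G (zinv G x) x = false by rewrite gs.
have sw x : zadj G w (zinv G x) = zadj G (zinv G w) x by rewrite -th tt.
split.
- exact: sym_rel_sym.
- by move=> [x|[]]; rewrite /= /sym_rel /= ?gi.
- exact: swapb_inv.
- move=> [x|b] [y|c]; rewrite /= /sym_rel /=.
  + rewrite !th !(inv_eqC _ _ tt) !tt !sw.
    by congr (_ || _); rewrite and5_swap.
  + by case: c; rewrite /= !(inv_eqC _ _ tt) ?tt // ?th ?sw.
  + by case: b; rewrite /= !(inv_eqC _ _ tt) ?tt // ?th ?sw.
  + by case: b; case: c.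
- exact: swapb_free.
- by move=> [x|[]]; rewrite /= /sym_rel /= ?tn ?tn1.
Qed.

Let FE' : zinv H @: F = [set p : zV G + bool |
   match p with inl x => x == t w | inr b => ~~ b end].
Proof.
have tH := z2_inv C4_z2free.
have [[gs gi tt th tf tn] _ _] := ciG.
apply/setP => p; rewrite -{1}(tH p) mem_imset; last exact: inv_inj.
by case: p => [x|b]; rewrite !inE //= inv_eqC.
Qed.

Let adjw x : x \notin [set w; t w] ->
  zadj H (inl w) (inl x) = r w x && ~~ [&& x != v1, x != v2 & M x].
Proof.
have [[gs gi tt th tf tn] _ _] := ciG.
rewrite !inE negb_or => /andP[xw xw'].
rewrite /= /sym_rel /= !eqxx (negbTE xw) (negbTE xw') ![w == zinv G w]eq_sym (negbTE (tf w)) /= ![zadj G x w]gs /r.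
by case: (zadj G w x) => //=; rewrite !andbT orbb.
Qed.

Let adju x : zadj H (inr true) (inl x) = [|| x == v1, x == v2 | [&& r w x, x != v1, x != v2 & M x]].
Proof. by rewrite /= /sym_rel /= orbF. Qed.

Let inji : injective (@inl (zV G) bool).
Proof. by move=> x y []. Qed.

Let cntw (B : {set zV G}) : [disjoint B & [set w; t w]] ->
  cnt (zadj H) [set inl w] (inl @: B) <= cnt r [set w] B.
Proof.
move=> dB; rewrite !cnt1l big_imset /=; last by move=> x y _ _ /inji.
apply: leq_sum => x xB; rewrite [sym_rel _ _ _](_ : _ = zadj H (inl w) (inl x)) //.
by rewrite adjw ?(disjointFr dB) //; case: (r w x) => //=; apply: leq_b1.
Qed.

Let cntu (B : {set zV G}) : cnt (zadj H) [set inr true] (inl @: B) <= cnt r [set w] B.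
Proof.
rewrite !cnt1l big_imset /=; last by move=> x y _ _ /inji.
apply: leq_sum => x xB; rewrite [sym_rel _ _ _](_ : _ = zadj H (inr true) (inl x)) //.
rewrite adju; have [->|_] := eqVneq x v1; first by rewrite /r wv1.
by have [->|_] := eqVneq x v2; [rewrite /r wv2|case: (r w x) => //=; apply: leq_b1].
Qed.

Let FU : F = inl w |: [set inr true].
Proof. by apply/setP=> [[x|[]]]; rewrite !inE ?orbF. Qed.

(** The vertices [v1] and [v2] are joined to both halves of [w], every other neighbour of [w] to
    exactly one. *)
Let cntF (B : {set zV G}) : [disjoint B & [set w; t w]] ->
  cnt (zadj H) F (inl @: B) = cnt r [set w] B + (v1 \in B) + (v2 \in B).
Proof.
move=> dB; rewrite FU cntUl ?disjoints1 ?inE // !cnt1l !big_imset /=; try by move=> x y _ _ /inji.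
rewrite -addnA.
have -> : (v1 \in B) + (v2 \in B) = \sum_(x in B) (x \in [:: v1; v2] : nat).
  by rewrite (@sum_pred _ _ [:: v1; v2]) ?big_cons ?big_nil ?addn0 //= mem_seq1 v12.
rewrite -!big_split /=; apply: eq_bigr => x xB.
rewrite [sym_rel _ (inl w) _](_ : _ = zadj H (inl w) (inl x)) //.
rewrite [sym_rel _ _ _](_ : _ = zadj H (inr true) (inl x)) //.
rewrite adjw ?adju ?(disjointFr dB) // mem_seq2.
have [->|_] := eqVneq x v1; first by rewrite /r wv1.
have [->|_] := eqVneq x v2; first by rewrite /r wv2.
by rewrite /=; case: (r w x); case: (M x).
Qed.

Let cardF : #|F| = 2.
Proof. by rewrite FU cardsU1 !inE cards1. Qed.

Let cntFF : cnt (zadj H) F F = 0.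
Proof.
have [[gs gi tt th tf tn] _ _] := ciG.
have wv x : zadj G w x -> (w == x) = false.
  by move=> wx; apply/negP => /eqP e; rewrite -e gi in wx.
apply: cnt_0 => p q; rewrite !inE; case: p => [x /eqP->|b ->]; case: q => [y /eqP->|c ->].
- by rewrite /= /sym_rel /= gi.
- by rewrite /= /sym_rel /= gi !wv.
- by rewrite /= /sym_rel /= gi !wv.
- by [].
Qed.

(** [F] is an independent pair. One half alone sends no more edges to [B] than [w] did; both
    together send at most two more, paid for by the extra vertex. *)
Lemma ci_C4 : ci H.
Proof.
have [[gs gi tt th tf tn] _ _] := ciG.
have tn1 x : zadj G (zinv G x) x = false by rewrite gs.
have wv' x : zadj G w x -> (w == x) = false.
  by move=> wx; apply/negP => /eqP e; rewrite -e gi in wx.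
have wv x : zadj G w x -> (zinv G w == x) = false.
  by move=> wx; apply/negP => /eqP e; rewrite -e tn in wx.
apply: (@ci_split _ _ r t w (zadj H) (zinv H) F ciG).
- exact: C4_z2free.
- by [].
- by move=> p; rewrite FE' !inE; case: p => // -[].
- apply: disjointI => p; rewrite FE' !inE; case: p => [x /eqP ->|[]] //.
  by rewrite eq_sym (negbTE (tf w)).
- move=> x y; rewrite !inE !negb_or => /andP[/negbTE xw /negbTE xw'] /andP[/negbTE yw /negbTE yw'].
  by rewrite /= /sym_rel /= xw xw' yw yw' /= !andbT [zadj G y x]gs orbb.
- move=> p q; rewrite FE' !inE; case: p => [x /eqP->|b ->]; case: q => [y /eqP->|c /negbTE->].
  + by rewrite /= /sym_rel /= tn tn1.
  + by rewrite /= /sym_rel /= tn1 -!(inv_eqC _ _ tt) !wv.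
  + by rewrite /= /sym_rel /= tn !wv.
  + by [].
- move=> A B sA A0 dB.
  have cAA : cnt (zadj H) A A = 0.
    by apply/eqP; rewrite -leqn0 -cntFF (leq_trans (cnt_subl _ _ sA)) // cnt_subr.
  rewrite cAA -card_gt0 in A0 *.
  have [wA|wA] := boolP (inl w \in A); have [uA|uA] := boolP (inr true \in A).
  + have -> : A = F.
      by apply/eqP; rewrite eqEsubset sA FU; apply/subsetP => p; rewrite !inE => /orP[]/eqP->.
    by rewrite cardF cntF //; move: (v1 \in B) (v2 \in B) (cnt _ _ _) => [] [] n; lia.
  + have -> : A = [set inl w].
      apply/setP=> p; rewrite inE; apply/idP/eqP => [pA|-> //].
      by move: (subsetP sA _ pA); rewrite FU !inE => /orP[]/eqP // e; rewrite -e pA in uA.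
    by have := cntw dB; rewrite cards1 -/r; cnt_lia.
  + have -> : A = [set inr true].
      apply/setP=> p; rewrite inE; apply/idP/eqP => [pA|-> //].
      by move: (subsetP sA _ pA); rewrite FU !inE => /orP[]/eqP // e; rewrite -e pA in wA.
    by have := cntu B; rewrite cards1 -/r; cnt_lia.
  + have [p pA] := card_gt0P A0; move: (subsetP sA _ pA); rewrite FU !inE.
    by case/orP=> /eqP e; rewrite -e pA in wA uA.
- set B := ~: _; rewrite /= cntF ?cntFF ?cardF; last by apply: disjointI => x; rewrite inE => /negP.
  (* Equality for the full fibre requires [v1] and [v2] to lie outside [w] and its image, which
     holds for all neighbours of [w]. *)
  have nw x : zadj G w x -> x \in B.
    by move=> wx; rewrite !inE eq_sym wv' // eq_sym wv.
  by rewrite !nw // /r; cnt_lia.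
Qed.

End C4.

(** If [S] meets both sides, adding the two sparsity bounds leaves a surplus of 4, exactly the
    ordered pairs of the two joining edges. These edges are distinct because no vertex is fixed. *)
Lemma ci_join (G1 G2 : z2graph) (x : zV G1) (y : zV G2) : ci G1 -> ci G2 -> ci (zjoin x y).
Proof.
move=> [[gs gi tt th tf tn] sp ti] [[gs2 gi2 tt2 th2 tf2 tn2] sp2 ti2].
have eqt := inj_eq (inv_inj tt); have eqt2 := inj_eq (inv_inj tt2).
set r := zadj (zjoin x y).
have e11 a b : r (inl a) (inl b) = zadj G1 a b by rewrite /r /= /sym_rel /= gs orbb.
have e22 a b : r (inr a) (inr b) = zadj G2 a b by rewrite /r /= /sym_rel /= gs2 orbb.
have e12 a b : r (inl a) (inr b) = ((a == x) && (b == y)) || ((a == zinv G1 x) && (b == zinv G2 y)).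
  by rewrite /r /= /sym_rel /= orbF.
have rs : symmetric r by exact: sym_rel_sym.
have E (S : {set zV (zjoin x y)}) : cnt r S S =
    cnt (zadj G1) (inl @^-1: S) (inl @^-1: S) + cnt (zadj G2) (inr @^-1: S) (inr @^-1: S)
    + 2 * ((inl x \in S) * (inr y \in S) + (inl (zinv G1 x) \in S) * (inr (zinv G2 y) \in S)).
  rewrite {1}/cnt sum_sumT.
  under eq_bigr => a _ do rewrite sum_sumT.
  under [X in _ + X]eq_bigr => b _ do rewrite sum_sumT.
  rewrite !big_split /=.
  have -> : \sum_(i in inr @^-1: S) \sum_(j in inl @^-1: S) r (inr i) (inl j) =
            \sum_(j in inl @^-1: S) \sum_(i in inr @^-1: S) r (inl j) (inr i).
    by rewrite exchange_big /=; apply: eq_bigr => a _; apply: eq_bigr => b _; rewrite rs.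
  have -> : \sum_(j in inl @^-1: S) \sum_(i in inr @^-1: S) r (inl j) (inr i) =
    (inl x \in S) * (inr y \in S) + (inl (zinv G1 x) \in S) * (inr (zinv G2 y) \in S).
    have s1 (V : finType) (A : {set V}) a : \sum_(i in A) (i == a : nat) = (a \in A).
      rewrite (@sum_pred _ _ [:: a]) ?big_cons ?big_nil ?addn0 //.
      by move=> i; rewrite /= mem_seq1.
    transitivity (\sum_(j in inl @^-1: S) \sum_(i in inr @^-1: S)
        ((j == x) * (i == y) + (j == zinv G1 x) * (i == zinv G2 y))).
      apply: eq_bigr => a _; apply: eq_bigr => b _; rewrite e12.
      have [->|_] := eqVneq a x; last by case: (a == zinv G1 x); case: (b == zinv G2 y).
      by rewrite [x == _]eq_sym (negbTE (tf x)) /= orbF; case: (b == y).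
    under eq_bigr => a _ do rewrite big_split /= -!big_distrr /= !s1 !inE.
    by rewrite big_split /= -!big_distrl /= !s1 !inE.
  rewrite (_ : cnt (zadj G1) _ _ = \sum_(i in inl @^-1: S) \sum_(j in inl @^-1: S) r (inl i) (inl j)); last first.
    by apply: eq_bigr => a _; apply: eq_bigr => b _; rewrite e11.
  rewrite (_ : cnt (zadj G2) _ _ = \sum_(i in inr @^-1: S) \sum_(j in inr @^-1: S) r (inr i) (inr j)); last first.
    by apply: eq_bigr => a _; apply: eq_bigr => b _; rewrite e22.
  by move: (_ * _ + _ * _) (\sum_(i in _) _) (\sum_(i in _) _) => a b c; clear; lia.
split.
- split=> //.
  + by move=> [a|a]; rewrite -/r ?e11 ?e22.
  + by move=> [a|a] /=; rewrite ?tt ?tt2.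
  + move=> [a|a] [b|b]; rewrite -/r /= ?e11 ?e22 ?th ?th2 ?e12 //.
      by rewrite !eqt !eqt2 !(inv_eqC _ _ tt) !(inv_eqC _ _ tt2) orbC.
    by rewrite !(rs (inr _)) !e12 !eqt !eqt2 !(inv_eqC _ _ tt) !(inv_eqC _ _ tt2) orbC.
  + by move=> [a|a] /=; apply/eqP=> -[]/eqP; rewrite ?(negbTE (tf a)) ?(negbTE (tf2 a)).
  + by move=> [a|a]; rewrite -/r /= ?e11 ?e22 ?tn ?tn2.
- move=> S _ S0; rewrite E card_sumT.
  have K (a b c d : bool) : 2 * (a * b + c * d) <= 4 by case: a b c d => [] [] [] [].
  have := K (inl x \in S) (inr y \in S) (inl (zinv G1 x) \in S) (inr (zinv G2 y) \in S).
  have [U0|U0] := eqVneq (inl @^-1: S) set0; have [U0'|U0'] := eqVneq (inr @^-1: S) set0.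
  + case/set0Pn: S0 => [[a|a]] aS; exfalso.
      by have := in_set0 a; rewrite -U0 inE aS.
    by have := in_set0 a; rewrite -U0' inE aS.
  + have nx a : inl a \in S = false by have := in_set0 a; rewrite -U0 inE.
    by rewrite !nx U0 cnt0l cards0; have := sp2 _ (subsetT _) U0'; cnt_lia.
  + have nx a : inr a \in S = false by have := in_set0 a; rewrite -U0' inE.
    by rewrite !nx !muln0 U0' cnt0l cards0; have := sp _ (subsetT _) U0; cnt_lia.
  + have := sp _ (subsetT _) U0; have := sp2 _ (subsetT _) U0'.
    by move: (2 * (_ + _)) => n; cnt_lia.
- rewrite /tight E card_sumT !inE.
  set A := inl @^-1: _; set B := inr @^-1: _.
  have -> : A = setT by apply/setP => a; rewrite !inE.
  have -> : B = setT by apply/setP => a; rewrite !inE.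
  by move: ti ti2; rewrite /tight; cnt_lia.
Qed.

(** * Tightness of the base graphs by evaluation *)

Fixpoint bitseqs n : seq bitseq :=
  if n is n'.+1 then map (cons true) (bitseqs n') ++ map (cons false) (bitseqs n') else [:: [::]].

Lemma mem_bitseqs (m : bitseq) : m \in bitseqs (size m).
Proof.
elim: m => // b m IH /=; rewrite mem_cat; apply/orP.
by case: b; [left|right]; rewrite map_f.
Qed.

Definition list_adj (l : seq (nat * nat)) (i j : nat) : bool := ((i, j) \in l) || ((j, i) \in l).

Definition bit_cnt (l : seq (nat * nat)) (n : nat) (m : bitseq) : nat :=
  sumn [seq sumn [seq nat_of_bool [&& nth false m i, nth false m j & list_adj l i j]
                 | j <- iota 0 n] | i <- iota 0 n].

(** The witness is the characteristic sequence of [S]; the right-hand sides are list computations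
    that can be evaluated. *)
Lemma cnt_bits n (l : seq (nat * nat)) (S : {set 'I_n}) :
  exists m : bitseq, [/\ size m = n, cnt (@adj_of_list n l) S S = bit_cnt l n m &
    #|S| = sumn [seq nat_of_bool (nth false m i) | i <- iota 0 n]].
Proof.
pose f i := [exists x : 'I_n, (val x == i) && (x \in S)].
have fE (x : 'I_n) : nth false (mkseq f n) x = (x \in S).
  rewrite nth_mkseq //; apply/existsP/idP => [[y /andP[/eqP/val_inj ->]] //|xS].
  by exists x; rewrite eqxx.
have sE (g : nat -> nat) : sumn [seq g i | i <- iota 0 n] = \sum_(i < n) g i.
  by rewrite sumnE big_map -{1}[n]subn0 -/(index_iota 0 n) big_mkord.
exists (mkseq f n); split; first exact: size_mkseq.
- rewrite /bit_cnt sE /cnt big_mkcond; apply: eq_bigr => x _; rewrite sE fE.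
  case: (x \in S); last by rewrite big1.
  rewrite big_mkcond; apply: eq_bigr => y _; rewrite fE.
  by case: (y \in S).
- by rewrite sE -sum1_card big_mkcond; apply: eq_bigr => x _; rewrite fE; case: (x \in S).
Qed.

(* Sparsity of the base graphs is decided by evaluation over all subsets, encoded as
   bit sequences. *)
Definition sparse_test (l : seq (nat * nat)) n : bool :=
  all (fun m => let k := sumn [seq nat_of_bool (nth false m i) | i <- iota 0 n] in
         (k == 0) || (bit_cnt l n m + 4 <= 4 * k)) (bitseqs n).

Lemma sparse_bits n (l : seq (nat * nat)) :
  sparse_test l n -> sparse_on (@adj_of_list n l) setT.
Proof.
move=> /allP H U _ U0; have [m [sm -> e]] := cnt_bits l U.
have mb : m \in bitseqs n by rewrite -sm mem_bitseqs.
by have := H m mb; rewrite /= -e cards_eq0 (negbTE U0).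
Qed.

Lemma adj_of_list_sym n l : symmetric (@adj_of_list n l).
Proof. by move=> x y; rewrite /adj_of_list orbC. Qed.

Lemma cnt_ord n (l : seq (nat * nat)) :
  cnt (@adj_of_list n l) setT setT = bit_cnt l n (nseq n true).
Proof.
have sE (g : nat -> nat) : sumn [seq g i | i <- iota 0 n] = \sum_(i < n) g i.
  by rewrite sumnE big_map -{1}[n]subn0 -/(index_iota 0 n) big_mkord.
rewrite /bit_cnt sE /cnt; apply: eq_big => [x|x _]; rewrite ?inE //.
by rewrite sE; apply: eq_big => [y|y _]; rewrite ?inE // !nth_nseq !ltn_ord.
Qed.

Lemma ci_F1 : ci F1.
Proof.
have vI (x : 'I_6) : val (zinv F1 x) = 5 - x by rewrite /= inordK // ltnS leq_subr.
split; [split| |].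
- exact: adj_of_list_sym.
- by case=> [[|[|[|[|[|[|]]]]]]].
- by move=> x; apply: val_inj; rewrite !vI; case: x => [[|[|[|[|[|[|]]]]]]].
- move=> x y; rewrite /= /adj_of_list !vI.
  by move: x y => [[|[|[|[|[|[|?]]]]]] // ?] [[|[|[|[|[|[|?]]]]]] // ?].
- by move=> x; apply/eqP => /(congr1 val); rewrite vI; case: x => [[|[|[|[|[|[|]]]]]]].
- move=> x; rewrite /= /adj_of_list !vI.
  by move: x => [[|[|[|[|[|[|?]]]]]] // ?].
- by apply: sparse_bits; vm_compute.
- by rewrite /tight [zadj F1]/(@adj_of_list 6 _) cnt_ord cardsT card_ord.
Qed.

Lemma ci_F2 : ci F2.
Proof.
have vI (x : 'I_8) : val (zinv F2 x) = F2_inv x.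
  by rewrite /= inordK //; case: x => [[|[|[|[|[|[|[|[|]]]]]]]]].
split; [split| |].
- exact: adj_of_list_sym.
- by case=> [[|[|[|[|[|[|[|[|]]]]]]]]].
- by move=> x; apply: val_inj; rewrite !vI; case: x => [[|[|[|[|[|[|[|[|]]]]]]]]].
- move=> x y; rewrite /= /adj_of_list !vI.
  by move: x y => [[|[|[|[|[|[|[|[|?]]]]]]]] // ?] [[|[|[|[|[|[|[|[|?]]]]]]]] // ?].
- by move=> x; apply/eqP => /(congr1 val); rewrite vI; case: x => [[|[|[|[|[|[|[|[|]]]]]]]]].
- move=> x; rewrite /= /adj_of_list !vI.
  by move: x => [[|[|[|[|[|[|[|[|?]]]]]]]] // ?].
- by apply: sparse_bits; vm_compute.
- by rewrite /tight [zadj F2]/(@adj_of_list 8 _) cnt_ord cardsT card_ord.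
Qed.

Lemma generated_ci (G : z2graph) : generated G -> ci G.
Proof.
elim=> {G} [H|H|G H a b _ ciG nab|G H a b c _ ciG ab _ ca cb|G H w d _ ciG _ _
  |G H w v1 v2 M _ ciG _ _ n12 a1 a2|G1 G2 H x y _ ci1 _ ci2 _] /ci_iso; apply.
- exact: ci_F1.
- exact: ci_F2.
- exact: ci_ext0.
- exact: ci_ext1.
- exact: ci_K4.
- exact: ci_C4.
- exact: ci_join.
Qed.

(** * Parity on invariant sets, and induced subgraphs *)

Definition tsym (V : finType) (t : V -> V) (U : {set V}) : bool := t @^-1: U == U.

Lemma tsymP (V : finType) (t : V -> V) (U : {set V}) :
  reflect (forall x, (t x \in U) = (x \in U)) (tsym t U).
Proof.
apply: (iffP eqP) => [/setP H x|H]; first by have := H x; rewrite inE.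
by apply/setP => x; rewrite inE.
Qed.

Section Free.
Variables (V : finType) (r : rel V) (t : V -> V).
Hypothesis zf : z2free r t.

Lemma cnt_preim (A B : {set V}) : cnt r (t @^-1: A) (t @^-1: B) = cnt r A B.
Proof.
have tt := z2_inv zf; have ti := inv_inj tt.
have E (U : {set V}) : t @^-1: U = t @: U.
  by apply/setP=> x; rewrite inE -{2}(tt x) mem_imset.
by rewrite !E cnt_imset //; apply: cnt_eq => x y _ _; apply: z2_hom zf _ _.
Qed.

Lemma card_tpreim (A : {set V}) : #|t @^-1: A| = #|A|.
Proof. by rewrite on_card_preimset //; exists t => x _; apply: z2_inv zf _. Qed.

(* For a transversal W of the orbits in U, [cnt r U U] is twice the sum of the counts in W
   of r and of the relation [r x (t y)], and both are symmetric and irreflexive. *)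
Lemma tsym_cnt4 (U : {set V}) : tsym t U -> 4 %| cnt r U U.
Proof.
have [gs gi tt th tf tn] := zf; move=> /tsymP Us.
pose W := [set x in U | enum_rank x < enum_rank (t x)].
have WE : U = W :|: t @^-1: W.
  apply/setP=> x; rewrite !inE Us tt; case: (x \in U) => //=.
  by rewrite -neq_ltn (inj_eq val_inj) (inj_eq enum_rank_inj) eq_sym tf.
have dW : [disjoint W & t @^-1: W].
  by apply: disjointI => x; rewrite !inE tt => /andP[_ a] /andP[_ b]; move: (ltn_trans a b); rewrite ltnn.
rewrite WE cntUU // cnt_preim.
have e1 := cnt_even gs gi W.
have gs' : symmetric (fun x y => r x (t y)) by move=> x y; rewrite -th tt gs.
have e2 := cnt_even gs' tn W.
have -> : cnt r W (t @^-1: W) = cnt (fun x y => r x (t y)) W W.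
  rewrite /cnt; apply: eq_bigr => x _.
  rewrite [LHS](reindex_inj (inv_inj tt)) /=; apply: eq_bigl => y; by rewrite inE tt.
by move: (cnt r W W) (cnt _ W W) e1 e2; clear; lia.
Qed.

Lemma tsymI (A B : {set V}) : tsym t A -> tsym t B -> tsym t (A :&: B).
Proof. by move=> /tsymP a /tsymP b; apply/tsymP => x; rewrite !inE a b. Qed.

Lemma tsymC (A : {set V}) : tsym t A -> tsym t (~: A).
Proof. by move=> /tsymP a; apply/tsymP => x; rewrite !inE a. Qed.

Lemma tsym_preU (A : {set V}) : tsym t (A :|: t @^-1: A).
Proof. by apply/tsymP => x; rewrite !inE (z2_inv zf) orbC. Qed.

Lemma tsym_preI (A : {set V}) : tsym t (A :&: t @^-1: A).
Proof. by apply/tsymP => x; rewrite !inE (z2_inv zf) andbC. Qed.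

Lemma tsym_pair (v : V) : tsym t [set v; t v].
Proof.
have tt := z2_inv zf.
by apply/tsymP => x; rewrite !inE !(inv_eqC _ _ tt) tt orbC.
Qed.

End Free.

(* [insubd x] returns the junk value x outside S; only t-invariant S are used. *)
Definition subz (V : finType) (r : rel V) (t : V -> V) (S : {set V}) : z2graph :=
  @Z2Graph {x | x \in S} (fun x y => r (val x) (val y)) (fun x => insubd x (t (val x))).

Section Sub.
Variables (V : finType) (r : rel V) (t : V -> V) (S : {set V}).
Hypothesis ciS : ci_on r t S.
Hypothesis Ss : tsym t S.
Let G := subz r t S.

Lemma val_subz (x : zV G) : val (zinv G x) = t (val x).
Proof. by rewrite /= insubdK // (tsymP _ _ Ss) (valP x). Qed.

Lemma ci_subz : ci G.
Proof.
have [[gs gi tt th tf tn] sp ti] := ciS.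
have cG (U : {set zV G}) : cnt (zadj G) U U = cnt r (val @: U) (val @: U).
  by rewrite cnt_imset //; exact: val_inj.
split.
- split.
  + by move=> x y; apply: gs.
  + by move=> x; apply: gi.
  + by move=> x; apply: val_inj; rewrite !val_subz tt.
  + by move=> x y; rewrite /zadj /= -/G !val_subz; apply: th.
  + by move=> x; rewrite -val_eqE val_subz tf.
  + by move=> x; rewrite /zadj /= val_subz tn.
- move=> U _ U0; rewrite cG -(card_imset _ val_inj); apply: sp.
    by apply/subsetP => _ /imsetP[x _ ->]; apply: valP.
  by case/set0Pn: U0 => x xU; apply/set0Pn; exists (val x); apply: imset_f.
- rewrite /tight cG -(card_imset _ val_inj).
  rewrite (_ : val @: setT = S) //; apply/setP => x; apply/imsetP/idP => [[y _ ->]|xS].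
    exact: valP.
  by exists (exist _ x xS).
Qed.

Lemma card_subz : #|zV G| = #|S|.
Proof. by rewrite card_sig; apply: eq_card => x. Qed.

End Sub.

Lemma z2iso_inj (G H : z2graph) (f : zV G -> zV H) : injective f -> #|zV H| <= #|zV G| ->
  (forall x y, zadj H (f x) (f y) = zadj G x y) ->
  (forall x, f (zinv G x) = zinv H (f x)) -> z2iso G H.
Proof. by move=> fi c fa fv; exists f; split=> //; apply: inj_card_bij. Qed.

Section PairIso.
Variables (V : finType) (r r2 : rel V) (t : V -> V) (v : V).
Let S := ~: [set v; t v].
Let G := subz r2 t S.
Variable rH : rel (zV G + bool).
Hypothesis zf : z2free r t.
Hypothesis zH : z2free rH (swapb (zinv G)).
Hypothesis h11 : forall x y, rH (inl x) (inl y) = r (val x) (val y).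
Hypothesis h21 : forall x, rH (inr true) (inl x) = r v (val x).
Hypothesis h22 : forall b c, rH (inr b) (inr c) = false.

Lemma tsym_delpair : tsym t S.
Proof. exact/tsymC/tsym_pair/zf. Qed.

Lemma card_delpair : #|V| = #|S| + 2.
Proof.
by rewrite -(cardsC [set v; t v]) cards2 eq_sym (z2_free zf) addnC.
Qed.

(** Common last step of inverting 0-extensions, 1-extensions and vertex-to-C4: a graph rebuilt on
    [S] plus a new pair is the original one. Adjacency is checked on [S] and at one new vertex only;
    the other new vertex follows by symmetry. The relation [r2] of the reduced graph may differ from
    [r]. *)
Lemma pair_iso : z2iso (Z2Graph rH (swapb (zinv G))) (Z2Graph r t).
Proof.
have [gs gi tt th tf tn] := zf.
have Ss := tsym_delpair.
have h21' (x : zV G) : rH (inr false) (inl x) = r (t v) (val x).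
  by rewrite -(z2_hom zH) /= h21 val_subz // -th tt.
have nS (x : zV G) b : val x <> if b then v else t v.
  by move=> e; have := valP x; rewrite e !inE; case: b {e}; rewrite eqxx ?orbT.
pose f (p : zV G + bool) : V := match p with inl x => val x | inr b => if b then v else t v end.
apply: (@z2iso_inj (Z2Graph rH (swapb (zinv G))) (Z2Graph r t) f).
- move=> [x|b] [y|c] /= => [/val_inj -> //|/nS //|/esym/nS //|].
  by case: b; case: c => // /eqP; rewrite ?(negbTE (tf v)) // eq_sym (negbTE (tf v)).
- by rewrite card_sum card_bool card_subz /= card_delpair.
- move=> [x|b] [y|c] /=.
  + by rewrite h11.
  + by rewrite (z2_sym zH) gs; case: c; rewrite ?h21 ?h21'.
  + by case: b; rewrite ?h21 ?h21'.
  + by rewrite h22; case: b; case: c; rewrite ?gi ?tn // gs tn.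
- by move=> [x|[]] //=; rewrite ?val_subz ?tt.
Qed.

End PairIso.

(** * Tight sets and degrees *)

Section Tight.
Variables (V : finType) (r : rel V) (t : V -> V).
Hypothesis zf : z2free r t.
Hypothesis sp : sparse_on r setT.
Hypothesis tiV : tight r setT.

Implicit Types A B S T U W : {set V}.
Implicit Types v x y : V.

Let gs := z2_sym zf.
Let gi := z2_irr zf.
Let tt := z2_inv zf.
Let tf := z2_free zf.
Let tn := z2_nofix zf.

Lemma tight_neq0 U : tight r U -> U != set0.
Proof. by apply: contraL => /eqP ->; rewrite /tight cnt0l cards0. Qed.

Lemma tight_preim U : tight r (t @^-1: U) = tight r U.
Proof. by rewrite /tight (cnt_preim zf) (card_tpreim zf). Qed.

(** The common vertex makes the intersection nonempty. Then f(A) + f(B) = 4 while union and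
    intersection each have f >= 2, so submodularity holds with equality throughout. *)
Lemma tight_UI A B x : tight r A -> tight r B -> x \in A -> x \in B ->
  [/\ tight r (A :|: B), tight r (A :&: B) & cnt r (A :\: B) (B :\: A) = 0].
Proof.
move=> tA tB xA xB.
have I0 : A :&: B != set0 by apply/set0Pn; exists x; rewrite inE xA.
have U0 : A :|: B != set0 by apply/set0Pn; exists x; rewrite inE xA.
move: (sp (subsetT _) I0) (sp (subsetT _) U0) (cnt_submod gs A B) (cardsUI A B) tA tB.
rewrite /tight; move: (cnt r (A :&: B) _) (cnt r (A :|: B) _) (cnt r (_ :\: _) _) (cnt r A A) (cnt r B B).
move: #|A :&: B| #|A :|: B| #|A| #|B| => a b c d e f g h i; clear => h1 h2 h3 h4 h5 h6.
by split; lia.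
Qed.

(** Here f of the union is 4 minus the number of edges between the sets, and it is at least 2. *)
Lemma tight_disjU A B : tight r A -> tight r B -> [disjoint A & B] ->
  cnt r A B <= 2 /\ (2 <= cnt r A B -> tight r (A :|: B)).
Proof.
move=> tA tB dAB; have U0 : A :|: B != set0.
  by have /set0Pn[x xA] := tight_neq0 tA; apply/set0Pn; exists x; rewrite inE xA.
have := sp (subsetT _) U0; move: tA tB.
rewrite /tight cntUU // cardsU disjoint_setI0 // cards0 subn0.
move: (cnt r A B) (cnt r A A) (cnt r B B) #|A| #|B| => a b c d e; clear => h1 h2 h3; split; lia.
Qed.

Lemma cnt_lt_tight U : U != set0 -> ~~ tight r U -> cnt r U U + 6 <= 4 * #|U|.
Proof.
move=> U0; have := sp (subsetT _) U0; have := cnt_even gs gi U.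
by rewrite /tight; move: (cnt r U U) #|U|; clear; lia.
Qed.

(** On invariant sets the count is a multiple of 4, so f jumps from 2 to at least 4. *)
Lemma cnt_lt_tight_sym U : tsym t U -> U != set0 -> ~~ tight r U -> cnt r U U + 8 <= 4 * #|U|.
Proof.
move=> Us U0; have := sp (subsetT _) U0; have := tsym_cnt4 zf Us.
by rewrite /tight; move: (cnt r U U) #|U|; clear; lia.
Qed.

(** A vertex of an invariant set of size n is adjacent in it neither to itself nor to its image.
    Hence 4n - 4 <= n(n-2), which fails for n from 2 to 5. *)
Lemma tight_sym_card U : tsym t U -> tight r U -> 6 <= #|U|.
Proof.
move=> /tsymP Us tU.
have b : cnt r U U <= #|U| * (#|U| - 2).
  rewrite {1}/cnt -sum_nat_const; apply: leq_sum => x xU.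
  rewrite (big_setD1 x xU) /= gi add0n (big_setD1 (t x)) /=; last by rewrite !inE tf Us.
  rewrite tn add0n (cardsD1 x U) xU (cardsD1 (t x) (U :\ x)) !inE tf Us xU /= -sum1_card addnA.
  by rewrite addKn; apply: leq_sum => y _; apply: leq_b1.
have c2 : 2 <= #|U|.
  have /set0Pn[x xU] := tight_neq0 tU.
  by rewrite (cardsD1 x U) xU (cardsD1 (t x) (U :\ x)) !inE tf Us xU.
move: c2 tU b; rewrite /tight; move: (cnt r U U) #|U| => a [|[|[|[|[|[|n]]]]]] //; clear; lia.
Qed.

Definition deg v := cnt r [set v] setT.

Lemma deg_card v : deg v = #|[pred y | r v y]|.
Proof.
by rewrite /deg cnt1l -sum1_card [RHS]big_mkcond; apply: eq_big => [y|y _]; rewrite ?inE //.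
Qed.

Lemma deg_enum v n : deg v = n -> exists s : seq V, [/\ uniq s, size s = n & forall y, r v y = (y \in s)].
Proof.
move=> e; exists (enum [pred y | r v y]); split; first exact: enum_uniq.
  by rewrite -cardE -deg_card.
by move=> y; rewrite mem_enum inE.
Qed.

Lemma deg_t v : deg (t v) = deg v.
Proof.
rewrite /deg -(cnt_preim zf) preimsetT; congr cnt; apply/setP=> x.
by rewrite !inE (inj_eq (inv_inj tt)).
Qed.

Lemma sum_deg : \sum_v deg v = 4 * #|V| - 4.
Proof.
have -> : \sum_v deg v = cnt r setT setT by rewrite cntE; apply: eq_bigl => x; rewrite inE.
by move: tiV; rewrite /tight cardsT; cnt_lia.
Qed.

Lemma cardV_gt0 : 0 < #|V|.
Proof. by have := tight_neq0 tiV; rewrite -card_gt0 cardsT. Qed.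

Lemma cnt_setT_D1 v : cnt r setT setT = cnt r (~: [set v]) (~: [set v]) + 2 * deg v.
Proof.
have -> : setT = v |: ~: [set v] by apply/setP=> x; rewrite !inE orbN.
rewrite cntU1 ?inE ?eqxx //; congr (_ + 2 * _).
rewrite /deg [in RHS](_ : setT = [set v] :|: ~: [set v]); last by apply/setP=> x; rewrite !inE orbN.
by rewrite cntUr ?disjoints1 ?inE ?eqxx // cnt11 gi.
Qed.

(** Deleting [v] from a tight graph leaves a nonempty sparse set, so at least two edges must
    disappear. *)
Lemma deg_ge2 v : 2 <= deg v.
Proof.
have n0 : ~: [set v] != set0 by apply/set0Pn; exists (t v); rewrite !inE tf.
move: (sp (subsetT _) n0) (cnt_setT_D1 v) tiV; rewrite /tight.
rewrite cardsC1 cardsT.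
have := cardV_gt0; move: #|V| (deg v) (cnt r _ _) (cnt r _ _); clear; lia.
Qed.

Lemma cnt_delpair v (S := ~: [set v; t v]) : cnt r setT setT = cnt r S S + 4 * deg v.
Proof.
have TE : setT = v |: (t v |: S).
  by apply/setP=> x; rewrite !inE orbA orbN.
have n1 : v \notin t v |: S by rewrite !inE eqxx /= orbF eq_sym tf.
have n2 : t v \notin S by rewrite !inE eqxx orbT.
have d1 : deg v = cnt r [set v] S.
  rewrite /deg TE cntUr ?disjoints1 // cntUr ?disjoints1 // !cnt11 gi tn //.
have d2 : deg v = cnt r [set t v] S.
  rewrite -deg_t /deg TE cntUr ?disjoints1 // cntUr ?disjoints1 // !cnt11 gi gs tn //.
rewrite TE !cntU1 // cntUr ?disjoints1 // cnt11 tn -d1 -d2; clear; lia.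
Qed.

End Tight.

(** * Inverting the operations *)

Section Reduce.
Variables (V : finType) (r : rel V) (t : V -> V).
Hypothesis zf : z2free r t.
Hypothesis sp : sparse_on r setT.
Hypothesis tiV : tight r setT.
Implicit Types A B S T U W : {set V}.
Implicit Types v w x y z : V.
Let gs := z2_sym zf.
Let gi := z2_irr zf.
Let tt := z2_inv zf.
Let th := z2_hom zf.
Let tf := z2_free zf.
Let tn := z2_nofix zf.
Let G0 := Z2Graph r t.
Hypothesis IH : forall G : z2graph, #|zV G| < #|V| -> ci G -> generated G.

Lemma nbr_delpair v y : r v y -> y \in ~: [set v; t v].
Proof.
move=> vy; rewrite !inE; apply/norP; split; apply/eqP => e; move: vy; rewrite e ?gi ?tn //.
Qed.

(** The induction hypothesis in the form used by the reductions that delete the pair [v], [t v];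
    [r2] is the possibly modified adjacency on the rest. *)
Lemma generated_subz (r2 : rel V) v :
  let S := ~: [set v; t v] in ci_on r2 t S -> generated (subz r2 t S) /\ ci (subz r2 t S).
Proof.
move=> S c; have Ss := tsym_delpair v zf.
have cS := ci_subz c Ss; split=> //; apply: IH => //.
by rewrite card_subz (card_delpair v zf) addn2.
Qed.

(** Deleting [v] and [t v] removes two vertices and four edges, so the rest is still tight. *)
Lemma red_ext0 v : deg r v = 2 -> generated G0.
Proof.
move=> d2; have [[|a [|b [|? ?]]] [us // _ vE]] := deg_enum d2.
have nab : a != b by move: us; rewrite /= mem_seq1 andbT.
have aS : a \in ~: [set v; t v] by apply: nbr_delpair; rewrite vE !inE eqxx.
have bS : b \in ~: [set v; t v] by apply: nbr_delpair; rewrite vE !inE eqxx orbT.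
set S := ~: [set v; t v] in aS bS.
have cS : ci_on r t S.
  split=> //; first by move=> U sU; apply: sp.
  move: tiV; rewrite /tight cardsT (card_delpair v zf) (cnt_delpair zf v) d2 -/S.
  by move: (cnt r S S) #|S|; clear; lia.
have [gS ciS] := generated_subz cS.
pose a' : zV (subz r t S) := exist _ a aS; pose b' : zV (subz r t S) := exist _ b bS.
have nab' : a' != b' by [].
apply: (gen_ext0 gS nab'); apply: pair_iso => //.
- by have [] := ci_ext0 ciS nab'.
- by move=> x y; rewrite /sym_rel /= [r (val y) _]gs orbb.
- by move=> x; rewrite /sym_rel /= orbF vE !inE.
- by case; case.
Qed.

Section AddEdge.
Variables (v x y : V).
Let S := ~: [set v; t v].
Hypothesis d3 : deg r v = 3.
Hypothesis xS : x \in S.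
Hypothesis yS : y \in S.
Hypothesis nxy : x != y.
Hypothesis nxty : y != t x.
Hypothesis rxy : r x y = false.
Hypothesis noblock : forall U, U \subset S -> x \in U -> y \in U -> ~~ tight r U.

(** Deleting the pair of degree-3 vertices removes six edges where tightness allows four, so two are
    put back. The assumption [y != t x] makes the edge and its image distinct and not fixed. *)
Definition add_edge : rel V := fun p q =>
  [|| r p q, same_pair p q x y | same_pair p q (t x) (t y)].

Let disj p q : same_pair p q x y -> same_pair p q (t x) (t y) = false.
Proof.
case/orP=> /andP[/eqP-> /eqP->]; apply/negP=> /orP[]/andP[/eqP e1 /eqP e2].
- by move: (tf x); rewrite -e1 eqxx.
- by move: nxty; rewrite e2 eqxx.
- by move: nxty; rewrite e1 eqxx.
- by move: (tf x); rewrite -e2 eqxx.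
Qed.

Let radd p q : same_pair p q x y -> r p q = false.
Proof. by case/orP=> /andP[/eqP-> /eqP->] //; rewrite gs. Qed.

Let radd' p q : same_pair p q (t x) (t y) -> r p q = false.
Proof. by case/orP=> /andP[/eqP-> /eqP->]; rewrite th // gs. Qed.

Lemma add_edge_cnt U : cnt add_edge U U = cnt r U U +
  (2 * ((x \in U) && (y \in U)) + 2 * ((t x \in U) && (t y \in U))).
Proof.
rewrite -!cnt_same_pair ?(inj_eq (inv_inj tt)) //.
rewrite -(@cntD _ (fun p q => same_pair p q x y || same_pair p q (t x) (t y))).
  apply: cntD => p q _ _; rewrite /add_edge.
  case: (boolP (same_pair p q x y)) => [/radd ->|_] //=.
  by case: (boolP (same_pair p q (t x) (t y))) => [/radd' ->|_] //=; rewrite orbF addn0.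
by move=> p q _ _; case: (boolP (same_pair p q x y)) => [/disj ->|_].
Qed.

Lemma add_edge_z2free : z2free add_edge t.
Proof.
have sw u w : same_pair (t u) (t w) x y = same_pair u w (t x) (t y).
  by rewrite -(same_pair_inv _ _ _ _ tt) !tt.
split=> //.
- by move=> p q; rewrite /add_edge gs ![same_pair p q _ _]same_pair_sym.
- move=> p; rewrite /add_edge gi /=; apply/negP => /orP[]/orP[]/andP[/eqP e1 /eqP].
  + by rewrite e1 => /eqP; rewrite (negbTE nxy).
  + by rewrite e1 => /eqP; rewrite eq_sym (negbTE nxy).
  + by rewrite e1 => /eqP; rewrite (inj_eq (inv_inj tt)) (negbTE nxy).
  + by rewrite e1 => /eqP; rewrite (inj_eq (inv_inj tt)) eq_sym (negbTE nxy).
- move=> p q; rewrite /add_edge th sw (same_pair_inv _ _ _ _ tt).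
  by congr (_ || _); rewrite orbC.
- move=> p; rewrite /add_edge tn /=; apply/negP => /orP[]/orP[]/andP[/eqP e1 /eqP].
  + by rewrite e1 => e; move: nxty; rewrite e eqxx.
  + by rewrite e1 => e; move: nxty; rewrite -e tt eqxx.
  + by rewrite e1 tt => e; move: nxty; rewrite e tt eqxx.
  + by rewrite e1 tt => e; move: nxty; rewrite e eqxx.
Qed.

(* A set U containing x, y, t x, t y with f(U) = 3 is excluded by parity: its intersection
   and union with its image are invariant, hence one of them would be tight. *)
Lemma ci_add_edge : ci_on add_edge t S.
Proof.
have Ss : tsym t S := tsym_delpair v zf.
split; first exact: add_edge_z2free.
- move=> U sU U0; rewrite add_edge_cnt.
  case: (boolP ((x \in U) && (y \in U))) => [/andP[xU yU]|n1]; last first.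
    case: (boolP ((t x \in U) && (t y \in U))) => [/andP[xU yU]|n2]; last first.
      by rewrite !muln0 !addn0; apply: sp.
    (* Only the image edge lies in [U], so [noblock] is applied to the image of [U]. *)
    have nt : ~~ tight r U.
      rewrite -(tight_preim zf); apply: noblock; rewrite ?inE //.
      by apply/subsetP => z; rewrite inE => /(subsetP sU); rewrite (tsymP _ _ Ss).
    by have := cnt_lt_tight zf sp U0 nt; move: (cnt r U U) #|U|; clear; lia.
  have nt := noblock sU xU yU.
  have := cnt_lt_tight zf sp U0 nt.
  case: (boolP ((t x \in U) && (t y \in U))) => [/andP[txU tyU]|n2]; last first.
    by move: (cnt r U U) #|U|; clear; lia.
  move=> _; set U' := t @^-1: U.
  have sU' : U' \subset S.
    by apply/subsetP => z; rewrite inE => /(subsetP sU); rewrite (tsymP _ _ Ss).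
  have x1 : x \in U :&: U' by rewrite !inE xU.
  have y1 : y \in U :&: U' by rewrite !inE yU.
  have x2 : x \in U :|: U' by rewrite !inE xU.
  have y2 : y \in U :|: U' by rewrite !inE yU.
  have n1 : ~~ tight r (U :&: U').
    by apply: noblock => //; apply: subset_trans sU; apply: subsetIl.
  have n2 : ~~ tight r (U :|: U') by apply: noblock => //; rewrite subUset sU.
  have i0 : U :&: U' != set0 by apply/set0Pn; exists x.
  have u0 : U :|: U' != set0 by apply/set0Pn; exists x.
  (* Both invariant sets have f >= 4, so submodularity gives f(U) >= 4: enough room for two
     edges. *)
  move: (cnt_lt_tight_sym zf sp (tsym_preI zf U) i0 n1) (cnt_lt_tight_sym zf sp (tsym_preU zf U) u0 n2).
  move: (cnt_submod gs U U') (cardsUI U U').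
  rewrite -/U' /U' (cnt_preim zf) (card_tpreim zf).
  by cnt_lia.
- move: tiV (add_edge_cnt S); rewrite /tight cardsT (card_delpair v zf) (cnt_delpair zf v) d3 -/S.
  rewrite !(tsymP _ _ Ss) xS yS /=.
  by move: (cnt r S S) (cnt _ S S) #|S|; clear; lia.
Qed.

End AddEdge.

Section ExtRed.
Variables (v x y z : V).
Hypothesis uN : uniq [:: x; y; z].
Hypothesis vE : forall q, r v q = (q \in [:: x; y; z]).
Let S := ~: [set v; t v].

Lemma N3_deg : deg r v = 3.
Proof.
rewrite deg_card (eq_card (B := mem [:: x; y; z])); last by move=> q; rewrite inE vE.
by rewrite (card_uniqP uN).
Qed.

Lemma N3_S q : q \in [:: x; y; z] -> q \in S.
Proof. by rewrite -vE; apply: nbr_delpair. Qed.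

Lemma red_ext1 : y != t x -> r x y = false ->
  (forall U, U \subset S -> x \in U -> y \in U -> ~~ tight r U) -> generated G0.
Proof.
move=> nxty rxy nb.
have [nxy [nxz nyz]] : x != y /\ x != z /\ y != z.
  by move: uN; rewrite /= mem_seq2 mem_seq1 negb_or andbT => /andP[/andP[-> ->] ->].
have xS : x \in S by apply: N3_S; rewrite !inE eqxx.
have yS : y \in S by apply: N3_S; rewrite !inE eqxx orbT.
have zS : z \in S by apply: N3_S; rewrite !inE eqxx !orbT.
have cS := ci_add_edge N3_deg xS yS nxy nxty rxy nb.
have [gS ciS] := generated_subz cS.
set H := subz _ _ _ in gS ciS.
pose x' : zV H := exist _ x xS; pose y' : zV H := exist _ y yS; pose z' : zV H := exist _ z zS.
have Ss : tsym t S := tsym_delpair v zf.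
have vz (q : zV H) : val (zinv H q) = t (val q) by apply: val_subz.
have sp' (p q c d : zV H) : same_pair p q c d = same_pair (val p) (val q) (val c) (val d).
  by rewrite /same_pair !val_eqE.
have axy : zadj H x' y' by rewrite /= /add_edge /same_pair !eqxx orbT.
have nzx : z' != x' by rewrite -val_eqE eq_sym.
have nzy : z' != y' by rewrite -val_eqE eq_sym.
apply: (gen_ext1 gS axy _ nzx nzy).
  rewrite sp' !vz /= /same_pair (negbTE (tf x)) /=.
  by apply/andP=> -[/eqP e _]; rewrite e eqxx in nxty.
apply: pair_iso => //.
- by have [] := ci_ext1 ciS axy nzx nzy.
- move=> p q; rewrite /sym_rel /= ![same_pair q p _ _]same_pair_sym !sp' !vz /=.
  rewrite /add_edge ![same_pair (val q) _ _ _]same_pair_sym [r (val q) _]gs orbb.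
  (* The added edges are absent from [r], so deleting them again in [ext1] restores [r]. *)
  case: (boolP (same_pair _ _ x y)) => [|_].
    by case/orP=> /andP[/eqP-> /eqP->]; rewrite ?andbF // gs rxy.
  case: (boolP (same_pair _ _ (t x) (t y))) => [|_]; last by rewrite !orbF !andbT.
  by case/orP=> /andP[/eqP-> /eqP->]; rewrite ?andbF // th // gs rxy.
- by move=> q; rewrite /sym_rel /= orbF vE !inE.
- by case; case.
Qed.

(* The vertex v is merged into u, that is, v is deleted and u z is added. *)
Lemma red_C4 u : u \in S -> u != z -> z != t u -> r u z = false -> r u x -> r u y ->
  (forall U, U \subset S -> u \in U -> z \in U -> ~~ tight r U) -> generated G0.
Proof.
move=> uS nuz nztu ruz rux ruy nb.
have [nxy [nxz nyz]] : x != y /\ x != z /\ y != z.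
  by move: uN; rewrite /= mem_seq2 mem_seq1 negb_or andbT => /andP[/andP[-> ->] ->].
have xS : x \in S by apply: N3_S; rewrite !inE eqxx.
have yS : y \in S by apply: N3_S; rewrite !inE eqxx orbT.
have zS : z \in S by apply: N3_S; rewrite !inE eqxx !orbT.
have cS := ci_add_edge N3_deg uS zS nuz nztu ruz nb.
have [gS ciS] := generated_subz cS.
set H := subz _ _ _ in gS ciS.
pose x' : zV H := exist _ x xS; pose y' : zV H := exist _ y yS.
pose u' : zV H := exist _ u uS.
(* Only the edge from [u] to [z] is moved, so the new vertex receives exactly the neighbours x, y
   and z of [v]. *)
pose M : pred (zV H) := fun q => val q == z.
have Ss : tsym t S := tsym_delpair v zf.
have vz (q : zV H) : val (zinv H q) = t (val q) by apply: val_subz.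
have [[Hs Hi Ht Hh Hf Hn] _ _] := ciS.
have aux : zadj H u' x' by rewrite /= /add_edge rux.
have auy : zadj H u' y' by rewrite /= /add_edge ruy.
have nxy' : x' != y' by [].
have auz : add_edge u z u z by rewrite /add_edge /same_pair !eqxx orbT.
have mvE q : [&& zadj H u' q, q != x', q != y' & M q] = (val q == z).
  rewrite /M -!val_eqE /=; have [->|_] := eqVneq (val q) z; last by rewrite !andbF.
  by rewrite auz !(eq_sym z) nxz nyz.
have mvE' q : [&& zadj H (zinv H u') q, zinv H q != x', zinv H q != y' & M (zinv H q)] = (val q == t z).
  by rewrite -(Hh _ q) Ht mvE vz inv_eqC.
have key (p q : zV H) : [&& zadj H p q, ~~ ((p == u') && (val q == z)), ~~ ((q == u') && (val p == z)),
    ~~ ((p == zinv H u') && (val q == t z)) & ~~ ((q == zinv H u') && (val p == t z))] = r (val p) (val q).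
  have h1 a b : (a == u) && (b == z) ==> ~~ r a b.
    by apply/implyP => /andP[/eqP-> /eqP->]; rewrite ruz.
  have h2 a b : (a == t u) && (b == t z) ==> ~~ r a b.
    by apply/implyP => /andP[/eqP-> /eqP->]; rewrite th ruz.
  rewrite -!val_eqE !vz /= /add_edge /same_pair ![(val p == _) && (val q == _)]andbC.
  move: (h1 (val p) (val q)) (h1 (val q) (val p)) (h2 (val p) (val q)) (h2 (val q) (val p)).
  rewrite [r (val q) _]gs ![(val p == _) && (val q == _)]andbC.
  by do 4!case: (_ && _); case: (r _ _).
apply: (gen_C4 (w := u') (v1 := x') (v2 := y') (M := M) gS (Hf _) _ nxy' aux auy).
  by rewrite Hn.
apply: pair_iso => //.
- by have [] := ci_C4 M ciS nxy' aux auy.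
- by move=> p q; rewrite /= /sym_rel /c4_raw !mvE !mvE' !key [r (val q) _]gs orbb.
- move=> q; rewrite /= /sym_rel /c4_raw !mvE orbF vE !inE -!val_eqE //.
- by case; case.
Qed.

End ExtRed.
End Reduce.

(** Propositional core of undoing a contraction: the edges added by contracting are among those that
    the vertex-to-K4 operation moves away, and none of the moved pairs was an edge [e] before. *)
Lemma moved_edges e a1 a2 b1 b2 c1 c2 d1 d2 a' b' c' d' :
  a1 && a2 ==> ~~ e -> b1 && b2 ==> ~~ e -> c1 && c2 ==> ~~ e -> d1 && d2 ==> ~~ e ->
  [&& [|| e, a1 && a' && a2 || c1 && c' && c2 | b1 && b' && b2 || d1 && d' && d2],
    ~~ (a1 && a2), ~~ (b1 && b2), ~~ (c1 && c2) & ~~ (d1 && d2)] = e.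
Proof.
rewrite ![_ && _ && a2]andbAC ![_ && _ && b2]andbAC ![_ && _ && c2]andbAC ![_ && _ && d2]andbAC.
by case: e; case: (a1 && a2); case: (b1 && b2); case: (c1 && c2); case: (d1 && d2); rewrite /= ?andbF.
Qed.

(* The clique K is contracted onto its vertex v, and its image onto t v. *)
Section Contract.
Variables (V : finType) (r : rel V) (t : V -> V).
Hypothesis zf : z2free r t.
Hypothesis sp : sparse_on r setT.
Hypothesis tiV : tight r setT.
Let gs := z2_sym zf.
Let gi := z2_irr zf.
Let tt := z2_inv zf.
Let th := z2_hom zf.
Let tf := z2_free zf.
Let tn := z2_nofix zf.
Let G0 := Z2Graph r t.
Implicit Types A B T U W : {set V}.
Variable K : {set V}.
Hypothesis Kclique : forall p q, p \in K -> q \in K -> r p q = (p != q).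

(** A vertex of the clique whose image is also in the clique would be joined to its image. *)
Lemma clique_disj : [disjoint K & t @^-1: K].
Proof.
apply: disjointI => p pK; rewrite inE => tpK.
by have := Kclique pK tpK; rewrite tn eq_sym tf.
Qed.

Variable v : V.
Hypothesis vK : v \in K.
Hypothesis cK : #|K| = 4.
Hypothesis vE : forall q, r v q -> q \in K.
Hypothesis nocross : forall p q, p \in K -> q \in K -> r p (t q) = false.
Hypothesis atmost1 : forall u p q, u \notin K -> p \in K -> q \in K -> r p u -> r q u -> p = q.
Hypothesis IH : forall G : z2graph, #|zV G| < #|V| -> ci G -> generated G.

Let X := K :\ v.
Let S := ~: (X :|: t @^-1: X).
Let nb q := [exists p, (p \in X) && r p q].
Let g p q := ((p == v) && (q != v) && nb q) || ((p == t v) && (q != t v) && nb (t q)).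
(** The vertices of [X] will be dropped and [v] inherits their neighbours, likewise for the images;
    the contracted graph is the restriction to [S]. *)
Definition contract : rel V := fun p q => [|| r p q, g p q | g q p].

Let XK p : p \in X -> p \in K.
Proof. by rewrite !inE => /andP[]. Qed.

Let nb_tv : nb (t v) = false.
Proof. by apply/existsP => -[p /andP[/XK pK]]; rewrite nocross. Qed.

Let cX : #|X| = 3.
Proof. by move: cK; rewrite (cardsD1 v) vK => -[]. Qed.

Let vS : v \in S.
Proof.
rewrite !inE eqxx /= negb_and; apply/orP; right; apply/negP => tvK.
by have := Kclique vK tvK; rewrite tn eq_sym tf.
Qed.

Lemma contract_z2free : z2free contract t.
Proof.
have sg p q : g (t p) (t q) = g p q.
  by rewrite /g !(inj_eq (inv_inj tt)) !(inv_eqC _ _ tt) !tt orbC.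
split=> //.
- by move=> p q; rewrite /contract gs [g q p || _]orbC.
- by move=> p; rewrite /contract gi /g; case: (p == v); case: (p == t v).
- by move=> p q; rewrite /contract th !sg.
- move=> p; rewrite /contract tn /g !(inv_eqC _ _ tt) !tt /=.
  have [->|_] /= := eqVneq p v; first by rewrite nb_tv !andbF.
  by have [->|_] //= := eqVneq p (t v); rewrite nb_tv.
Qed.

Let SE q : q \in S -> q != v -> q \notin K.
Proof. by rewrite !inE negb_or negb_and negbK => /andP[/orP[->|]]. Qed.

Let Ss : tsym t S.
Proof. exact/tsymC/(tsym_preU zf). Qed.

Let SE' q : q \in S -> q != t v -> t q \notin K.
Proof. by move=> qS qv; apply: SE; rewrite ?(tsymP _ _ Ss) ?(inv_eqC _ _ tt). Qed.

(** By [atmost1] an outside vertex has at most one neighbour in the clique, and by [vE] it is not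
    [v]. Contracting therefore merges no two edges. *)
Let cnt_nb U : U \subset S -> v \notin U -> \sum_(q in U) (nb q : nat) = cnt r K U.
Proof.
move=> sU vU; rewrite (cntC gs) [in RHS]/cnt; apply: eq_bigr => q qU.
have qK : q \notin K.
  by apply: SE; [apply: (subsetP sU) | apply: contraNneq vU => <-].
have vq : r q v = false by rewrite gs; apply/negP => /vE; rewrite (negbTE qK).
rewrite -(setD1K vK) big_setU1 ?inE ?eqxx //= vq add0n.
case: (boolP (nb q)) => [|/existsPn n].
  rewrite /nb => /existsP[p /andP[pX pq]].
  rewrite (big_setD1 p pX) /= [r q p]gs pq big1 ?addn0 // => p'; rewrite !inE => /and3P[np _ p'K].
  apply/eqP; rewrite eqb0 gs; apply/negP => p'q.
  by rewrite (atmost1 qK p'K (XK pX) p'q pq) eqxx in np.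
rewrite big1 // => p pX; apply/eqP; rewrite eqb0 gs.
by have := n p; rewrite pX.
Qed.

Let cnt_c1 U : U \subset S -> v \notin U -> t v \notin U -> cnt contract [set v] U = cnt r K U.
Proof.
move=> sU vU tvU; rewrite -cnt_nb // cnt1l; apply: eq_bigr => q qU.
have qv : q != v by apply: contraNneq vU => <-.
have vq : r v q = false.
  by apply/negP => /vE; apply/negP/SE => //; apply: (subsetP sU).
have -> : contract v q = nb q; last by [].
by rewrite /contract vq /g eqxx qv (negbTE qv) [v == t v]eq_sym (negbTE (tf v)) /= nb_tv !andbF !orbF.
Qed.

Let cnt_c2 U : U \subset S -> v \notin U -> t v \notin U ->
  cnt contract [set t v] U = cnt r (t @^-1: K) U.
Proof.
move=> sU vU tvU; have z := contract_z2free.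
rewrite -(cnt_preim z) -[in RHS](cnt_preim zf).
have -> : t @^-1: (t @^-1: K) = K by apply/setP=> p; rewrite !inE tt.
have -> : t @^-1: [set t v] = [set v] by apply/setP=> p; rewrite !inE (inj_eq (inv_inj tt)).
apply: cnt_c1; rewrite ?inE ?tt //.
by apply/subsetP => p; rewrite inE => /(subsetP sU); rewrite (tsymP _ _ Ss).
Qed.

Let cnt_c0 U : U \subset S -> v \notin U -> t v \notin U -> cnt contract U U = cnt r U U.
Proof.
move=> sU vU tvU; apply: cnt_eq => p q pU qU; rewrite /contract /g.
have [/negbTE-> /negbTE->] : p != v /\ p != t v by split; [apply: contraNneq vU => <- | apply: contraNneq tvU => <-].
have [/negbTE-> /negbTE->] : q != v /\ q != t v by split; [apply: contraNneq vU => <- | apply: contraNneq tvU => <-].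
by rewrite /= !orbF.
Qed.

Let disjK U : U \subset S -> v \notin U -> [disjoint K & U].
Proof.
move=> sU vU; apply: disjointI => p pK pU; move: pK; apply/negP/SE.
  exact: (subsetP sU).
by apply: contraNneq vU => <-.
Qed.

Let disjtK U : U \subset S -> t v \notin U -> [disjoint t @^-1: K & U].
Proof.
move=> sU vU; apply: disjointI => p pK pU; move: pK; rewrite inE; apply/negP/SE'.
  exact: (subsetP sU).
by apply: contraNneq vU => <-.
Qed.

Let cKK : cnt r K K = 12.
Proof. by rewrite (cnt_clique Kclique) cK. Qed.

Let ctK : cnt r (t @^-1: K) (t @^-1: K) = 12.
Proof. by rewrite (cnt_preim zf) cKK. Qed.

Let cKtK : cnt r K (t @^-1: K) = 0.
Proof. by apply: cnt_0 => p q pK; rewrite inE => qK; rewrite -(tt q) nocross. Qed.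

Let ctKc : #|t @^-1: K| = 4.
Proof. by rewrite (card_tpreim zf). Qed.

(* W' is W with v and t v, when present, blown up to K and its image. *)
Let uncontract W : W \subset S -> W != set0 -> exists W' k,
  [/\ W' != set0, cnt contract W W + 12 * k = cnt r W' W', #|W'| = #|W| + 3 * k & (W = S -> W' = setT)].
Proof.
move=> sW W0; pose U := W :\: [set v; t v].
have sU : U \subset S by apply: subset_trans sW; apply: subsetDl.
have vU : v \notin U by rewrite !inE eqxx.
have tvU : t v \notin U by rewrite !inE eqxx orbT.
have ne x A : x \in A -> A != set0 by move=> xA; apply/set0Pn; exists x.
have zc := contract_z2free.
have cs := z2_sym zc; have ci := z2_irr zc.
have c0 := cnt_c0 sU vU tvU; have c1 := cnt_c1 sU vU tvU; have c2 := cnt_c2 sU vU tvU.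
have dK := disjK sU vU; have dtK := disjtK sU tvU.
have tvS : t v \in S by rewrite (tsymP _ _ Ss).
have [vW|vW] := boolP (v \in W); have [tvW|tvW] := boolP (t v \in W).
- have WE : W = v |: (t v |: U).
    apply/setP=> p; rewrite !inE; case: eqVneq => [->|_] //=.
    by case: eqVneq => [->|_].
  (* [k] is the number of blown-up vertices. Each blow-up adds 3 vertices and 6 edges, that is 12
     ordered pairs, which leaves f unchanged. *)
  exists (K :|: (t @^-1: K :|: U)), 2.
  have n1 : v \notin t v |: U by rewrite !inE eqxx orbF eq_sym tf.
  have d2 : [disjoint K & t @^-1: K :|: U].
    by apply: disjointI => p pK /setUP[]; rewrite ?(disjointFr dK pK) ?(disjointFr clique_disj pK).
  split.
  + by apply: (ne v); rewrite inE vK.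
  + rewrite WE !cntU1 // cntUr ?disjoints1 // cnt11 (z2_nofix zc) c0 c1 c2.
    by rewrite !cntUU // cntUr // cKK ctK cKtK; cnt_lia.
  + rewrite !cardsU !disjoint_setI0 // cards0 cK ctKc WE !cardsU1 n1 tvU.
    by cnt_lia.
  + move=> eS; apply/setP=> p; rewrite in_setT.
    have [pS|pS] := boolP (p \in W).
      by move: pS; rewrite WE !inE => /or3P[/eqP->|/eqP->|->]; rewrite ?vK ?tt ?vK ?orbT.
    by move: pS; rewrite eS inE negbK !in_setU => /orP[/XK->//|]; rewrite !inE => /andP[_ ->]; rewrite orbT.
- have WE : W = v |: U.
    apply/setP=> p; rewrite !inE; case: eqVneq => [->|_] //=.
    by case: eqVneq => [->|_] //=; apply/negbTE.
  exists (K :|: U), 1; split.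
  + by apply: (ne v); rewrite inE vK.
  + by rewrite WE !cntU1 // c0 c1 cntUU // cKK; cnt_lia.
  + by rewrite !cardsU !disjoint_setI0 // cards0 cK WE !cardsU1 vU; cnt_lia.
  + by move=> e; rewrite e tvS in tvW.
- have WE : W = t v |: U.
    apply/setP=> p; rewrite !inE; case: (eqVneq p v) => [->|_] //=.
      by rewrite eq_sym (negbTE (tf v)); apply/negbTE.
    by case: eqVneq => [->|_] //=.
  exists (t @^-1: K :|: U), 1; split.
  + by apply: (ne (t v)); rewrite !inE tt vK.
  + by rewrite WE !cntU1 // c0 c2 cntUU // ctK; cnt_lia.
  + by rewrite !cardsU !disjoint_setI0 // cards0 ctKc WE !cardsU1 tvU; cnt_lia.
  + by move=> e; rewrite e vS in vW.
- have WE : W = U.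
    apply/setP=> p; rewrite !inE; case: (eqVneq p v) => [->|_] //=; first exact/negbTE.
    by case: eqVneq => [->|_] //=; apply/negbTE.
  exists W, 0; split=> //.
  + by rewrite muln0 addn0 {1 2}WE c0 -WE.
  + by rewrite muln0 addn0.
  + by move=> e; rewrite e vS in vW.
Qed.

Lemma ci_contract : ci_on contract t S.
Proof.
split; first exact: contract_z2free.
- move=> W sW W0; have [W' [k [W'0 e1 e2 _]]] := uncontract sW W0.
  by move: (sp (subsetT _) W'0) e1 e2; cnt_lia.
- have S0 : S != set0 by apply/set0Pn; exists v.
  have [W' [k [W'0 e1 e2 e]]] := uncontract (subxx S) S0.
  by move: tiV; rewrite -(e erefl) /tight; move: e1 e2; cnt_lia.
Qed.


Let card_S : #|V| = #|S| + 6.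
Proof.
rewrite -(cardsC (X :|: t @^-1: X)) cardsU disjoint_setI0 ?cards0 ?(card_tpreim zf) ?cX -/S; first by cnt_lia.
apply: disjointI => p /XK pK; rewrite inE => /XK tpK.
by have := disjointFr clique_disj pK; rewrite inE tpK.
Qed.

Let Xn (i : 'I_3) : V := enum_val (cast_ord (esym cX) i).

Let XnX i : Xn i \in X.
Proof. exact: enum_valP. Qed.

Let Xn_inj : injective Xn.
Proof. by move=> i j /enum_val_inj /cast_ord_inj. Qed.

Let Xn_surj p : p \in X -> exists i, Xn i = p.
Proof.
move=> pX; exists (cast_ord cX (enum_rank_in pX p)).
by rewrite /Xn cast_ordK enum_rankK_in.
Qed.

Lemma red_K4 : generated G0.
Proof.
have ciH := ci_subz ci_contract Ss.
set H := subz _ _ _ in ciH.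
have gH : generated H by apply: IH => //; rewrite card_subz card_S; cnt_lia.
have vz (q : zV H) : val (zinv H q) = t (val q) by apply: val_subz.
have [[Hs Hi Ht Hh Hf Hn] _ _] := ciH.
pose w : zV H := exist _ v vS.
(* The choice is the neighbour of [q] in [X], unique for [q] other than [w]. At [w], which is joined
   to all of [X], it is arbitrary, and harmless since [w] is not its own neighbour. *)
pose d (q : zV H) : option 'I_3 := [pick i | r (Xn i) (val q)].
have nbE q : nb (val q) = (d q != None).
  rewrite /d; case: pickP => [i ri|n]; first by apply/existsP; exists (Xn i); rewrite XnX.
  by apply/negbTE/existsPn => p; apply/negP => /andP[/Xn_surj[i <-]]; rewrite n.
have dE q i : q != w -> (d q == Some i) = r (Xn i) (val q).
  rewrite -val_eqE /= => qv; have qK := SE (valP q) qv; rewrite /d; case: pickP => [j rj|n]; last by rewrite n.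
  apply/eqP/idP => [[<-] //|ri]; congr Some; apply: Xn_inj.
  exact: atmost1 qK (XK (XnX _)) (XK (XnX _)) rj ri.
have rvS q : q \in S -> r v q = false.
  move=> qS; apply/negP => vq; have [e|nqv] := eqVneq q v; first by rewrite e gi in vq.
  by have := SE qS nqv; rewrite vE.
have tvS q : q \in S -> r (t v) q = false.
  by move=> qS; rewrite -(tt q) th rvS // (tsymP _ _ Ss).
have cw q : q != w -> zadj H w q = nb (val q).
  rewrite -val_eqE /= => qv.
  rewrite /contract rvS ?(valP q) // /g eqxx qv (negbTE qv) [v == t v]eq_sym (negbTE (tf v)) /=.
  by rewrite nb_tv !andbF !orbF.
have zH := K4_z2free w d ciH.
apply: (@gen_K4 H G0 w d gH (Hf w)); first by rewrite Hn.
set HK := vertex_to_K4 w d in zH *.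
pose f (p : zV HK) : V := match p with inl x => val x | inr (b, i) => if b then Xn i else t (Xn i) end.
have XS p : p \in S -> p \in X -> False by rewrite !inE negb_or => /andP[/negP a _] b; apply: a.
have fS (x : zV H) b i : val x <> if b then Xn i else t (Xn i).
  move=> e; have xS := valP x; rewrite e in xS; case: b {e} xS => xS.
    exact: XS xS (XnX i).
  by rewrite (tsymP _ _ Ss) in xS; exact: XS xS (XnX i).
have ktk p q : p \in X -> q \in X -> p <> t q.
  move=> /XK pK /XK qK e; have := disjointFr clique_disj pK.
  by rewrite inE e tt qK.
have h11 x y : zadj HK (inl x) (inl y) = r (val x) (val y).
  have key (p q : zV H) : [&& zadj H p q, ~~ ((p == w) && (d q != None)), ~~ ((q == w) && (d p != None)),
    ~~ ((p == zinv H w) && (d (zinv H q) != None)) & ~~ ((q == zinv H w) && (d (zinv H p) != None))]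
    = r (val p) (val q).
    rewrite -!nbE -!val_eqE !vz /= /contract /g.
    have h1 a b : a \in S -> b \in S -> (a == v) && nb b ==> ~~ r a b.
      by move=> aS bS; apply/implyP => /andP[/eqP-> _]; rewrite rvS.
    have h2 a b : a \in S -> b \in S -> (a == t v) && nb (t b) ==> ~~ r a b.
      by move=> aS bS; apply/implyP => /andP[/eqP-> _]; rewrite tvS.
    apply: moved_edges.
    - exact: h1 (valP p) (valP q).
    - rewrite gs; exact: h1 (valP q) (valP p).
    - exact: h2 (valP p) (valP q).
    - rewrite gs; exact: h2 (valP q) (valP p).
  by rewrite /= /sym_rel /k4_raw !key [r (val y) _]gs orbb.
have h21 i x : zadj HK (inr (true, i)) (inl x) = r (Xn i) (val x).
  have -> : zadj HK (inr (true, i)) (inl x) = (x == w) || (zadj H w x && (d x == Some i)).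
    by rewrite /= /sym_rel /= orbF.
  have [->|nx] := eqVneq x w.
    rewrite /= (Kclique (XK (XnX i)) vK); apply/esym.
    by have := XnX i; rewrite !inE => /andP[].
  rewrite cw // dE //= andb_idl // => ri.
  by apply/existsP; exists (Xn i); rewrite XnX.
have h21' i x : zadj HK (inr (false, i)) (inl x) = r (t (Xn i)) (val x).
  rewrite -(z2_hom zH) [LHS](_ : _ = zadj HK (inr (true, i)) (inl (zinv H x))) //.
  by rewrite h21 vz -th tt.
apply: (@z2iso_inj HK G0 f).
- move=> [x|[b i]] [y|[c j]] /= => [/val_inj -> //|/fS //|/esym/fS //|].
  case: b; case: c => e.
  + by rewrite (Xn_inj e).
  + by have := ktk _ _ (XnX i) (XnX j) e.
  + by have := ktk _ _ (XnX j) (XnX i) (esym e).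
  + by rewrite (Xn_inj (inv_inj tt e)).
- by rewrite card_sum card_prod card_bool card_ord card_subz /= card_S.
- move=> [x|[b i]] [y|[c j]].
  + by rewrite h11.
  + by rewrite (z2_sym zH); case: c; rewrite ?h21 ?h21'; apply: gs.
  + by case: b; rewrite ?h21 ?h21'.
  + have kk k l : r (Xn k) (Xn l) = (k != l).
      by rewrite (Kclique (XK (XnX k)) (XK (XnX l))) (inj_eq Xn_inj).
    have kt k l : r (Xn k) (t (Xn l)) = false by rewrite nocross // XK.
    have -> : zadj HK (inr (b, i)) (inr (c, j)) = (b == c) && (i != j).
      by rewrite /= /sym_rel /=; case: b; case: c => //=; rewrite [j == i]eq_sym orbb.
    by case: b; case: c; rewrite /= ?th ?kk ?kt // gs kt.
- by move=> [x|[[] i]] //=; rewrite ?vz ?tt.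
Qed.

End Contract.

(** * Vertices of degree three and the join decomposition *)

Section Decompose.
Variables (V : finType) (r : rel V) (t : V -> V).
Hypothesis zf : z2free r t.
Hypothesis sp : sparse_on r setT.
Hypothesis tiV : tight r setT.
Hypothesis IH : forall G : z2graph, #|zV G| < #|V| -> ci G -> generated G.
Implicit Types A B S T U W K : {set V}.
Let gs := z2_sym zf.
Let gi := z2_irr zf.
Let tt := z2_inv zf.
Let th := z2_hom zf.
Let tf := z2_free zf.
Let G0 := Z2Graph r t.

Definition N3 v x y z := uniq [:: x; y; z] /\ forall q, r v q = (q \in [:: x; y; z]).

Lemma N3_rot v x y z : N3 v x y z -> N3 v y z x.
Proof.
move=> [u e]; split; first by rewrite -(rot_uniq 2).
by move=> q; rewrite e !inE orbC -orbA.
Qed.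

Lemma N3_swap v x y z : N3 v x y z -> N3 v y x z.
Proof.
move=> [u e]; split; last by move=> q; rewrite e !inE orbCA.
by move: u; rewrite /= !mem_seq2 !mem_seq1 !negb_or !andbT [y == x]eq_sym => /andP[/andP[-> ->] ->].
Qed.

Lemma N3_deg3 v : deg r v = 3 -> exists x y z, N3 v x y z.
Proof.
move=> /deg_enum[[|x [|y [|z [|? ?]]]] [u // _ e]]; by exists x, y, z.
Qed.

Lemma N3_neq v x y z : N3 v x y z -> [/\ x != y, x != z & y != z].
Proof. by move=> [] /=; rewrite mem_seq2 mem_seq1 negb_or andbT => /andP[/andP[-> ->] ->]. Qed.

Lemma N3_nbr v x y z : N3 v x y z -> [/\ r v x, r v y & r v z].
Proof. by move=> [_ e]; rewrite !e !inE !eqxx !orbT. Qed.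

Section Node.
Variable v : V.
Let S := ~: [set v; t v].

Lemma S_notv U : U \subset S -> v \notin U.
Proof. by move=> sU; apply/negP => /(subsetP sU); rewrite !inE eqxx. Qed.

(** Adding [v] brings one vertex and three edges, so f would drop from 2 to 1. *)
Lemma tight3 x y z U : N3 v x y z -> tight r U -> v \notin U -> x \in U -> y \in U -> z \in U -> False.
Proof.
move=> [u e] tU vU xU yU zU; have n0 : v |: U != set0 by apply/set0Pn; exists v; rewrite setU11.
have := sp (subsetT _) n0; rewrite cntU1 // cardsU1 vU cnt1l.
rewrite (@sum_pred _ _ [:: x; y; z]) //.
rewrite !big_cons big_nil xU yU zU; move: tU; rewrite /tight.
by move: (cnt r U U) #|U|; clear; lia.
Qed.

(** Sets blocking two different pairs share a neighbour of [v], so their union is tight and contains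
    all three neighbours. *)
Lemma block_two x y z U1 U2 : N3 v x y z -> U1 \subset S -> U2 \subset S -> tight r U1 -> tight r U2 ->
  x \in U1 -> y \in U1 -> x \in U2 -> z \in U2 -> False.
Proof.
move=> N s1 s2 t1 t2 x1 y1 x2 z2.
have [tU _ _] := tight_UI zf sp t1 t2 x1 x2.
apply: (tight3 N tU); rewrite ?inE ?x1 ?y1 ?z2 ?orbT //.
by rewrite negb_or !S_notv.
Qed.

(** With two edges into [U], the vertex [z] can be added while keeping [U] tight; then all three
    neighbours are inside. *)
Lemma block_edges x y z U : N3 v x y z -> U \subset S -> tight r U -> x \in U -> y \in U ->
  r x z -> r y z -> False.
Proof.
move=> N sU tU xU yU xz yz.
have [nxy nxz nyz] := N3_neq N; have [vx vy vz] := N3_nbr N.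
have zU : z \notin U by apply/negP => zU; apply: (tight3 N tU) => //; apply: S_notv.
have n0 : z |: U != set0 by apply/set0Pn; exists z; rewrite setU11.
have c2 : 2 <= cnt r [set z] U.
  apply: (@cnt_ge2 _ _ _ _ z x z y); rewrite ?inE ?eqxx //.
  - by rewrite gs.
  - by rewrite gs.
  - by rewrite xpair_eqE eqxx.
have tzU : tight r (z |: U).
  move: (sp (subsetT _) n0) tU; rewrite /tight cntU1 // cardsU1 zU.
  by move: (cnt r U U) (cnt r _ U) #|U| c2; clear; lia.
apply: (tight3 N tzU); rewrite ?inE ?xU ?yU ?eqxx ?orbT //.
by rewrite negb_or S_notv // andbT; apply/eqP => e; rewrite e gi in vz.
Qed.

(* U and its image either meet, or are joined by the edges x z and t x t z; in both cases
   their union is tight and contains all neighbours of v. *)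
Lemma block_image x y z U : N3 v x y z -> U \subset S -> tight r U -> y = t x -> r x z ->
  y \in U -> z \in U -> False.
Proof.
move=> N sU tU exy xz yU zU.
have [nxy nxz nyz] := N3_neq N.
pose U' := t @^-1: U.
have Ss : tsym t S := tsym_delpair v zf.
have sU' : U' \subset S.
  by apply/subsetP => q; rewrite inE => /(subsetP sU); rewrite (tsymP _ _ Ss).
have xU' : x \in U' by rewrite inE -exy.
have tU' : tight r U' by rewrite (tight_preim zf).
have tUU : tight r (U :|: U').
  have [w /andP[wU wU']|d] := pickP [pred w | (w \in U) && (w \in U')].
    by have [] := tight_UI zf sp tU tU' wU wU'.
  have dU : [disjoint U & U'] by apply: disjointI => w wU wU'; have := d w; rewrite /= wU wU'.
  have [_ H] := tight_disjU zf sp tU tU' dU; apply: H.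
  apply: (@cnt_ge2 _ _ _ _ z x y (t z)) => //; rewrite ?inE ?tt //.
  - by rewrite gs.
  - by rewrite exy th.
  - by rewrite xpair_eqE eq_sym (negbTE nyz).
apply: (tight3 N tUU); rewrite ?inE ?yU ?zU -?exy ?yU ?orbT //.
have := S_notv sU; have := S_notv sU'; rewrite inE => a b; by rewrite negb_or b.
Qed.

(** The three obstacles are the ways in which the hypotheses of [red_ext1] can fail. *)
Lemma pair_cases x y z : N3 v x y z -> generated G0 \/
  [\/ r x y, y = t x | exists U, [/\ U \subset S, tight r U, x \in U & y \in U]].
Proof.
move=> N; have [uN vE] := N.
case: (boolP (r x y)) => [xy|rxy]; first by right; constructor 1.
case: (eqVneq y (t x)) => [e|nxy]; first by right; constructor 2.
case: (boolP [exists U : {set V}, [&& U \subset S, tight r U, x \in U & y \in U]]) => [/existsP[U /and4P[]]|/existsPn n].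
  by move=> *; right; constructor 3; exists U.
left; apply: (red_ext1 zf sp tiV IH uN vE nxy (negbTE rxy)) => U sU xU yU.
by have := n U; rewrite sU xU yU !andbT.
Qed.

Lemma node_cases : deg r v = 3 -> [\/ generated G0,
   exists x y z, N3 v x y z /\ [/\ r x y, r x z & r y z] |
   exists x z, [/\ N3 v x (t x) z, r x z & r (t x) z]].
Proof.
move=> /N3_deg3[x [y [z N]]].
have Nyzx := N3_rot N; have Nzxy := N3_rot Nyzx; have Nyxz := N3_swap N.
have Nxzy := N3_rot Nyxz; have Nzyx := N3_rot Nxzy.
have [nxy nxz nyz] := N3_neq N.
have [|c1] := pair_cases N; first by constructor 1.
have [|c2] := pair_cases Nxzy; first by constructor 1.
have [|c3] := pair_cases Nyzx; first by constructor 1.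
have inj a b : t a = t b -> a = b by apply: inv_inj.
(* Each of the pairs xy, xz, yz is an edge ([E]), an orbit ([I]) or blocked ([U]). Three edges give
   K4, and one orbit with two edges gives the F1 case. Two orbits would share a vertex, and the
   block lemmas exclude the rest: two blocks, one block with two edges, or one of each kind. *)
case: c1 => [E1|I1|[U1 [s1 t1 x1 y1]]]; case: c2 => [E2|I2|[U2 [s2 t2 x2 z2]]];
  case: c3 => [E3|I3|[U3 [s3 t3 y3 z3]]].
- by constructor 2; exists x, y, z.
- by constructor 3; exists y, x; rewrite -I3 gs E1 gs E2.
- by case: (block_edges Nyzx s3 t3 y3 z3); rewrite gs.
- by constructor 3; exists x, y; rewrite -I2 E1 gs E3.
- by case/eqP: nxy; apply: inj; rewrite -I2.
- by case: (block_image Nxzy s3 t3 I2 E1 z3 y3).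
- by case: (block_edges Nxzy s2 t2 x2 z2); rewrite // gs.
- by case: (block_image Nyzx s2 t2 I3 _ z2 x2); rewrite gs.
- by case: (block_two Nzxy s2 s3 t2 t3 z2 x2 z3 y3).
- by constructor 3; exists x, z; rewrite -I1 E2 E3.
- by case/eqP: nxz; rewrite I3 I1 tt.
- by case: (block_image N s3 t3 I1 E2 y3 z3).
- by case/eqP: nyz; rewrite I1 I2.
- by case/eqP: nyz; rewrite I1 I2.
- by case/eqP: nyz; rewrite I1 I2.
- by case: (block_image Nyxz s2 t2 _ E3 x2 z2); rewrite I1 tt.
- by case/eqP: nxz; rewrite I3 I1 tt.
- by case: (block_two Nzxy s2 s3 t2 t3 z2 x2 z3 y3).
- by case: (block_edges N s1 t1 x1 y1).
- by case: (block_image Nzyx s1 t1 _ _ y1 x1); rewrite ?I3 ?tt // -I3 gs.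
- by case: (block_two Nyxz s1 s3 t1 t3 y1 x1 y3 z3).
- by case: (block_image Nzxy s1 t1 _ _ x1 y1); rewrite ?I2 ?tt // -I2 gs.
- by case/eqP: nxy; apply: inj; rewrite -I2.
- by case: (block_two Nyxz s1 s3 t1 t3 y1 x1 y3 z3).
- by case: (block_two N s1 s2 t1 t2 x1 y1 x2 z2).
- by case: (block_two N s1 s2 t1 t2 x1 y1 x2 z2).
- by case: (block_two N s1 s2 t1 t2 x1 y1 x2 z2).
Qed.

End Node.

(** Minimal invariant tight sets, in boolean form so that the family of all of them can be collected
    in a set. *)
Definition atom T : bool := [&& tsym t T, tight r T &
  [forall B : {set V}, [&& B \subset T, tsym t B & tight r B] ==> (B == T)]].

Lemma atomP T : reflect [/\ tsym t T, tight r T & forall B, B \subset T -> tsym t B -> tight r B -> B = T]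
  (atom T).
Proof.
apply: (iffP and3P) => -[a b c]; split=> //.
  by move=> B sB B1 B2; move/forallP: c => /(_ B); rewrite sB B1 B2 => /eqP.
by apply/forallP => B; apply/implyP => /and3P[*]; apply/eqP/c.
Qed.

(** The intersection is invariant and tight, so by minimality it equals both atoms. *)
Lemma atom_eq T1 T2 x : atom T1 -> atom T2 -> x \in T1 -> x \in T2 -> T1 = T2.
Proof.
move=> /atomP[s1 t1 m1] /atomP[s2 t2 m2] x1 x2.
have [_ tI _] := tight_UI zf sp t1 t2 x1 x2; have sI := tsymI s1 s2.
by rewrite -(m1 _ (subsetIl _ _) sI tI) (m2 _ (subsetIr _ _) sI tI).
Qed.

(** Divisibility by 4 makes the number of outgoing edges even, and sparsity of the complement makes
    it at least 2. So it is exactly 2 and the complement is tight as well. *)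
Lemma red_join T : tsym t T -> tight r T -> T != setT -> cnt r T (~: T) <= 3 -> generated G0.
Proof.
move=> Ts tT TT c3.
have Cs := tsymC Ts; have C0 : ~: T != set0.
  by apply: contra TT => /eqP e; rewrite -[T]setCK e setC0.
have dT : [disjoint T & ~: T] by apply: disjointI => x; rewrite inE => xT /negP.
have TE : T :|: ~: T = setT by rewrite setUCr.
have cE := cntUU gs dT; rewrite TE in cE.
have cc := cardsC T.
have e2 : cnt r T (~: T) = 2 /\ tight r (~: T).
  have d4 := tsym_cnt4 zf (U := setT) _; rewrite /tsym preimsetT eqxx in d4.
  move: (sp (subsetT _) C0) tiV tT cE (d4 isT) (tsym_cnt4 zf Ts) (tsym_cnt4 zf Cs) c3 cc.
  rewrite /tight cardsT.
  move: (cnt r T (~: T)) (cnt r T T) (cnt r (~: T) (~: T)) (cnt r setT setT) #|T| #|~: T| #|V|.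
  by clear => a b c d e f g h1 h2 h3 h4 h5 h6 h7 h8 h9; split; lia.
case: e2 => e2 tC.
have [x [y [xT yC xy]]] : exists x y, [/\ x \in T, y \in ~: T & r x y].
  have : 0 < cnt r T (~: T) by rewrite e2.
  rewrite cnt_card => /card_gt0P[[x y]]; rewrite inE => /and3P[xT yC xy].
  by exists x, y.
have txT : t x \in T by rewrite (tsymP _ _ Ts).
have tyC : t y \in ~: T by rewrite (tsymP _ _ Cs).
(* An outgoing edge and its image are distinct, hence they are the only two outgoing edges. *)
have cross a b : a \in T -> b \in ~: T ->
    r a b = ((a == x) && (b == y)) || ((a == t x) && (b == t y)).
  move=> aT bC; move: e2; rewrite cnt_card => /eqP e2.
  have sub : [set (x, y); (t x, t y)] \subset
      [set p : V * V | [&& p.1 \in T, p.2 \in ~: T & r p.1 p.2]].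
    by apply/subsetP => p; rewrite in_set2 => /orP[]/eqP->; rewrite inE /= ?xT ?yC ?txT ?tyC ?th.
  have/setP/(_ (a, b)) : [set (x, y); (t x, t y)] = [set p : V * V | [&& p.1 \in T, p.2 \in ~: T & r p.1 p.2]].
    apply/eqP; rewrite eqEcard sub (eqP e2) cards2 xpair_eqE.
    by rewrite eq_sym (negbTE (tf x)).
  by rewrite in_set2 inE /= aT bC !xpair_eqE /= => <-.
have spA A : sparse_on r A by move=> U sU; apply: sp.
have ciT : ci_on r t T by split.
have ciC : ci_on r t (~: T) by split.
have c1 := ci_subz ciT Ts; have c2 := ci_subz ciC Cs.
set H1 := subz r t T in c1; set H2 := subz r t (~: T) in c2.
have v1 (q : zV H1) : val (zinv H1 q) = t (val q) by apply: val_subz.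
have v2 (q : zV H2) : val (zinv H2 q) = t (val q) by apply: val_subz.
have T0 := tight_neq0 tT; rewrite -card_gt0 in T0; rewrite -card_gt0 in C0.
have g1 : generated H1 by apply: IH => //; rewrite card_subz -cc; move: C0; cnt_lia.
have g2 : generated H2 by apply: IH => //; rewrite card_subz -cc; move: T0; cnt_lia.
pose x' : zV H1 := exist _ x xT; pose y' : zV H2 := exist _ y yC.
have cJ := ci_join x' y' c1 c2; have [zJ _ _] := cJ.
apply: (@gen_join H1 H2 G0 x' y' g1 g2).
  by rewrite -val_eqE v1 (negbTE (tf _)).
pose f (p : zV (zjoin x' y')) : V := match p with inl a => val a | inr b => val b end.
have TC a b : a \in T -> b \in ~: T -> a <> b by move=> aT; rewrite inE => /negP bT e; case: bT; rewrite -e.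
have h12 (a : zV H1) (b : zV H2) : zadj (zjoin x' y') (inl a) (inr b) = r (val a) (val b).
  by rewrite /= /sym_rel /= orbF (cross _ _ (valP a) (valP b)) -!val_eqE !v1 !v2.
apply: (@z2iso_inj (zjoin x' y') G0 f).
- move=> [a|a] [b|b] /= => [/val_inj->//|e|e|/val_inj->//].
    by case: (TC _ _ (valP a) (valP b)).
  by case: (TC _ _ (valP b) (valP a)).
- by rewrite card_sum !card_subz cc.
- move=> [a|a] [b|b].
  + by rewrite /= /sym_rel /= [r (val b) _]gs orbb.
  + by rewrite h12.
  + by rewrite (z2_sym zJ) h12; apply: gs.
  + by rewrite /= /sym_rel /= [r (val b) _]gs orbb.
- by move=> [a|a]; rewrite /= ?v1 ?v2.
Qed.

(* An atom T with at least 4 outgoing edges satisfies [4 * #|T| <= \sum_(v in T) deg r v];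
   if all did, the degree sum would be at least 4|V|. *)
Lemma atoms_split : (forall v, 3 <= deg r v) ->
  (forall v, deg r v = 3 -> exists2 T, atom T /\ T != setT & v \in T) -> generated G0.
Proof.
move=> d3 H; pose P := [set T | atom T && (T != setT)].
case: (boolP [exists T in P, cnt r T (~: T) <= 3]) => [/existsP[T]|/existsPn n].
  by rewrite inE => /andP[/andP[/atomP[Ts tT _] TT] c]; apply: red_join tT TT c.
have trP : trivIset P.
  apply/trivIsetP => A B; rewrite !inE => /andP[aA _] /andP[aB _] nAB.
  by apply: disjointI => x xA xB; case/eqP: nAB; apply: atom_eq xA xB.
have dP T : T \in P -> 4 * #|T| <= \sum_(v in T) deg r v.
  move=> TP; have := n T; rewrite TP /= -ltnNge => c4.
  move: TP; rewrite inE => /andP[/atomP[Ts tT _] _].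
  have -> : \sum_(v in T) deg r v = cnt r T T + cnt r T (~: T).
    rewrite -cntUr; first by rewrite setUCr cntE.
    by apply: disjointI => x; rewrite inE => xT /negP.
  have := tsym_cnt4 zf Ts; have := tsym_cnt4 zf (tsymC Ts).
  have d4 := tsym_cnt4 zf (U := setT) _; rewrite /tsym preimsetT eqxx in d4; have := d4 isT.
  move: tT c4; rewrite /tight; cnt_lia.
have c1 : 4 * #|cover P| <= \sum_(v in cover P) deg r v.
  rewrite big_trivIset //= -(eqP trP) big_distrr /=; exact: leq_sum.
(* Vertices of degree 3 lie in proper atoms, so all degrees outside the atoms of [P] are at least
   4. *)
have c2 : 4 * #|~: cover P| <= \sum_(v in ~: cover P) deg r v.
  rewrite mulnC -sum_nat_const; apply: leq_sum => v; rewrite inE => vP.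
  rewrite ltn_neqAle d3 andbT; apply: contra vP => /eqP e.
  have [T [aT TT] vT] := H v (esym e); apply/bigcupP; exists T => //.
  by rewrite inE aT.
have := sum_deg tiV.
have -> : \sum_v deg r v = \sum_(v in cover P) deg r v + \sum_(v in ~: cover P) deg r v.
  rewrite (bigID (mem (cover P))) /=; congr (_ + _); by apply: eq_bigl => v; rewrite ?inE.
have := cardsC (cover P); have := cardV_gt0 tiV.
move: c1 c2; move: (\sum_(v in cover P) _) (\sum_(v in ~: _) _).
by cnt_lia.
Qed.

End Decompose.

(** * Copies of the base graphs *)

Section Embed.
Variables (V : finType) (r : rel V) (t : V -> V).
Hypothesis zf : z2free r t.
Variables (F : z2graph) (f : zV F -> V).
Hypothesis ciF : ci F.
Hypothesis fi : injective f.
Hypothesis fa : forall x y, r (f x) (f y) = zadj F x y.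
Hypothesis fv : forall x, f (zinv F x) = t (f x).
Let T := f @: [set: zV F].

Lemma embed_tight : tight r T.
Proof.
have [_ _] := ciF; rewrite /tight cnt_imset // card_imset //.
by rewrite (@cnt_eq _ (relpre f r) (zadj F)) // => x y _ _; apply: fa.
Qed.

Lemma embed_tsym : tsym t T.
Proof.
have tt := z2_inv zf.
apply/tsymP => x; apply/imsetP/imsetP => -[y _ e].
  by exists (zinv F y); rewrite ?inE // fv -e tt.
by exists (zinv F y); rewrite ?inE // fv -e.
Qed.

Lemma embed_card : #|T| = #|zV F|.
Proof. by rewrite card_imset // cardsT. Qed.

Lemma embed_iso : T = setT -> z2iso F (Z2Graph r t).
Proof. by move=> e; apply: (@z2iso_inj F (Z2Graph r t) f) => //=; rewrite -embed_card e cardsT. Qed.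

End Embed.

Section BaseCopies.
Variables (V : finType) (r : rel V) (t : V -> V).
Hypothesis zf : z2free r t.
Hypothesis sp : sparse_on r setT.
Implicit Types A B S T U W K : {set V}.
Let gs := z2_sym zf.
Let gi := z2_irr zf.
Let tt := z2_inv zf.
Let th := z2_hom zf.
Let tf := z2_free zf.
Let tn := z2_nofix zf.
Let G0 := Z2Graph r t.

Let th1 (a b : V) : r (t a) b = r a (t b).
Proof. by rewrite -th tt. Qed.

Let gsT (a b : V) : r a (t b) = r b (t a).
Proof. by rewrite -th1 gs. Qed.

Let eqt (a b : V) : (t a == t b) = (a == b).
Proof. exact/inj_eq/inv_inj. Qed.

Let neqE (a b : V) : a != b -> ((a == b) = false) * ((b == a) = false).
Proof. by rewrite [b == a]eq_sym => /negbTE ->. Qed.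

Let neqtE (a b : V) : a != t b -> ((a == t b) = false) * ((t b == a) = false) *
  ((t a == b) = false) * ((b == t a) = false).
Proof.
by rewrite [t b == a]eq_sym [b == t a]eq_sym !(inv_eqC a _ tt) => /negbTE ->.
Qed.

Let tfE (a : V) : ((t a == a) = false) * ((a == t a) = false).
Proof. by rewrite [a == t a]eq_sym (negbTE (tf a)). Qed.

(** The six vertices span F1. They form an atom because an invariant tight set has at least six
    vertices; if they are everything, the graph is F1 itself. *)
Lemma F1_copy v x z : N3 r v x (t x) z -> r x z -> r (t x) z ->
  exists T, [/\ atom r t T, v \in T & T = setT -> generated G0].
Proof.
move=> N xz txz; have [nxtx nxz ntxz] := N3_neq N; have [vx vtx vz] := N3_nbr N.
have [_ vE] := N; rewrite [t x == z]eq_sym in ntxz.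
have vtz : r v (t z) = false.
  by rewrite vE !inE eqt (neqE nxz) (neqtE ntxz) tfE.
have nvx : v != x by apply: contraTneq vx => <-; rewrite gi.
have nvz : v != z by apply: contraTneq vz => <-; rewrite gi.
have nvtx : v != t x by apply: contraTneq vtx => <-; rewrite gi.
have nvtz : v != t z by apply: contraTneq vz => ->; rewrite gs tn.
have [vv xx zz] : [/\ r v v = false, r x x = false & r z z = false] by rewrite !gi.
have [xv zv zx] : [/\ r x v, r z v & r z x] by rewrite ![r _ v]gs [r z x]gs.
have [vtv xtx ztz] : [/\ r v (t v) = false, r x (t x) = false & r z (t z) = false] by rewrite !tn.
have [xtv ztv xtz ztx] : [/\ r x (t v), r z (t v) = false, r x (t z) & r z (t x)].
  by rewrite (gsT x v) (gsT z v) (gsT z x) -[r x _]th1 vtx vtz txz.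
(* The order is that of a, b, c, d, e, f in F1, so [t] reverses the list. *)
pose s := [:: v; z; x; t x; t z; t v].
have us : uniq s.
  by rewrite /= !inE !eqt !(neqE nvx, neqE nvz, neqE nxz, neqtE nvtx, neqtE nvtz, neqtE ntxz, tfE).
pose f (i : zV F1) := nth v s i.
have fi : injective f.
  by move=> i j /eqP; rewrite /f nth_uniq // => /eqP/val_inj.
have vI (i : 'I_6) : val (zinv F1 i) = 5 - i by rewrite /= inordK // ltnS leq_subr.
have fv i : f (zinv F1 i) = t (f i).
  by rewrite /f vI; case: i => [[|[|[|[|[|[|?]]]]]] // ?]; rewrite /= ?tt.
have fa i j : r (f i) (f j) = zadj F1 i j.
  rewrite /f; move: i j => [[|[|[|[|[|[|?]]]]]] // ?] [[|[|[|[|[|[|?]]]]]] // ?]; rewrite /= ?th ?th1;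
  by rewrite ?vv ?xx ?zz ?vx ?vz ?xz ?xv ?zv ?zx ?vtv ?xtx ?ztz ?vtx ?vtz ?xtz ?xtv ?ztv ?ztx.
have tT := embed_tight ci_F1 fi fa; have Ts := embed_tsym zf fv; have cT := embed_card fi.
exists (f @: [set: zV F1]); split.
- apply/atomP; split=> // B sB Bs tB; apply/eqP; rewrite eqEcard sB cT card_ord.
  exact: tight_sym_card Bs tB.
- by apply/imsetP; exists (ord0 : 'I_6).
- by move=> e; apply: gen_F1; apply: embed_iso fa fv e.
Qed.

Lemma tri_clique v (K := [set q | (q == v) || r v q]) x y z :
  N3 r v x y z -> r x y -> r x z -> r y z ->
  [/\ forall p q, p \in K -> q \in K -> r p q = (p != q), #|K| = 4 & K = [set v; x; y; z]].
Proof.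
move=> N xy xz yz; have [nxy nxz nyz] := N3_neq N; have [vx vy vz] := N3_nbr N.
have [_ vE] := N.
have KE : K = [set v; x; y; z].
  by apply/setP=> q; rewrite !inE vE !inE !orbA.
have nvx : v != x by apply: contraTneq vx => <-; rewrite gi.
have nvy : v != y by apply: contraTneq vy => <-; rewrite gi.
have nvz : v != z by apply: contraTneq vz => <-; rewrite gi.
split=> //; last first.
  rewrite KE (setUC _ [set z]) cardsU1 (setUC _ [set y]) cardsU1 cards2 !inE.
  by rewrite !(neqE nvx, neqE nvy, neqE nvz, neqE nxy, neqE nxz, neqE nyz).
have [yx zx zy] : [/\ r y x, r z x & r z y] by rewrite ![r z _]gs [r y x]gs.
have [xv yv zv] : [/\ r x v, r y v & r z v] by rewrite ![r _ v]gs.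
have H p : p \in K -> [\/ p = v, p = x, p = y | p = z].
  by rewrite KE !inE -!orbA => /or4P[]/eqP; [constructor 1|constructor 2|constructor 3|constructor 4].
move=> p q /H pK /H qK.
by case: pK => ->; case: qK => ->; rewrite ?gi ?eqxx ?vx ?vy ?vz ?xv ?yv ?zv ?xy ?xz ?yx ?yz ?zx ?zy
   ?(neqE nvx) ?(neqE nvy) ?(neqE nvz) ?(neqE nxy) ?(neqE nxz) ?(neqE nyz).
Qed.

Lemma clique_tight K : (forall p q, p \in K -> q \in K -> r p q = (p != q)) -> #|K| = 4 -> tight r K.
Proof. by move=> H c; rewrite /tight (cnt_clique H) c. Qed.

(** A clique on a vertices is tight only if a(a-1) + 4 = 4a, that is for a = 1 or a = 4. *)
Lemma sub_clique K A : (forall p q, p \in K -> q \in K -> r p q = (p != q)) -> #|K| = 4 ->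
  A \subset K -> tight r A -> 2 <= #|A| -> A = K.
Proof.
move=> H c sA tA c2; apply/eqP; rewrite eqEcard sA c.
have HA : forall p q, p \in A -> q \in A -> r p q = (p != q).
  by move=> p q pA qA; apply: H; apply: (subsetP sA).
have := subset_leq_card sA; move: tA c2; rewrite /tight (cnt_clique HA) c.
by case: #|A| => [|[|[|[|[|n]]]]].
Qed.

(** The clique [K] and its image are disjoint tight sets, so the edge from x to [t y] and its image
    are all the edges between them. An invariant tight subset has at least six vertices, so it meets
    [K] in at least three; this intersection is tight, hence all of [K]. *)
Lemma F2_copy v x y z : N3 r v x y z -> r x y -> r x z -> r y z -> r x (t y) ->
  exists T, [/\ atom r t T, v \in T & T = setT -> generated G0].
Proof.
move=> N xy xz yz xty; have [nxy nxz nyz] := N3_neq N.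
have [Kc cK KE] := tri_clique N xy xz yz; set K := [set q | _] in Kc cK KE; clearbody K.
have dK : [disjoint K & t @^-1: K] := clique_disj zf Kc.
have tK := clique_tight Kc cK.
have ttK : tight r (t @^-1: K) by rewrite (tight_preim zf).
have [vK xK yK zK] : [/\ v \in K, x \in K, y \in K & z \in K] by rewrite KE !inE !eqxx !orbT.
have [c2 _] := tight_disjU zf sp tK ttK dK.
have ytx : r y (t x) by rewrite gsT.
have cross a b : a \in K -> b \in K -> r a (t b) = same_pair a b x y.
  move=> aK bK; move: c2; rewrite cnt_card => c2.
  pose E := [set p : V * V | [&& p.1 \in K, p.2 \in t @^-1: K & r p.1 p.2]].
  have sub : [set (x, t y); (y, t x)] \subset E.
    by apply/subsetP => p; rewrite in_set2 => /orP[]/eqP->; rewrite !inE /= ?tt ?xK ?yK.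
  have EE : [set (x, t y); (y, t x)] = E.
    by apply/eqP; rewrite eqEcard sub cards2 xpair_eqE (neqE nxy).
  move/setP/(_ (a, t b)): EE; rewrite in_set2 inE /= inE tt aK bK /= => <-.
  by rewrite !xpair_eqE !eqt.
have nvx : v != x by apply/eqP=> e; have := Kc _ _ vK xK; have [-> _ _] := N3_nbr N; rewrite e eqxx.
have nvy : v != y by apply/eqP=> e; have := Kc _ _ vK yK; have [_ -> _] := N3_nbr N; rewrite e eqxx.
have nvz : v != z by apply/eqP=> e; have := Kc _ _ vK zK; have [_ _ ->] := N3_nbr N; rewrite e eqxx.
have nt a b : a \in K -> b \in K -> a != t b.
  by move=> aK bK; apply/eqP => e; have := disjointFr dK aK; rewrite inE e tt bK.
(* The order is a1, ..., a4, b1, ..., b4: the crossing edges join x to [t y] and y to [t x], while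
   the involution of F2 exchanges a3 with b4. *)
pose s := [:: v; z; x; y; t v; t z; t y; t x].
have us : uniq s.
  rewrite /= !inE !eqt !(neqE nvx, neqE nvz, neqE nvy, neqE nxz, neqE nxy, neqE nyz).
  by rewrite ?(neqtE (nt v v vK vK), neqtE (nt v x vK xK), neqtE (nt v y vK yK), neqtE (nt v z vK zK),
    neqtE (nt x x xK xK), neqtE (nt x y xK yK), neqtE (nt x z xK zK),
    neqtE (nt y y yK yK), neqtE (nt y z yK zK), neqtE (nt z z zK zK)).
pose f (i : zV F2) := nth v s i.
have fi : injective f.
  by move=> i j /eqP; rewrite /f nth_uniq // => /eqP/val_inj.
have vI (i : 'I_8) : val (zinv F2 i) = F2_inv i.
  by rewrite /= inordK //; case: i => [[|[|[|[|[|[|[|[|?]]]]]]]] // ?].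
have fv i : f (zinv F2 i) = t (f i).
  by rewrite /f vI; case: i => [[|[|[|[|[|[|[|[|?]]]]]]]] // ?]; rewrite /= ?tt.
have fa i j : r (f i) (f j) = zadj F2 i j.
  rewrite /f; move: i j => [[|[|[|[|[|[|[|[|?]]]]]]]] // ?] [[|[|[|[|[|[|[|[|?]]]]]]]] // ?]; rewrite /= ?th ?th1;
  by rewrite ?cross ?Kc // /same_pair ?eqxx
    ?(neqE nvx, neqE nvz, neqE nvy, neqE nxz, neqE nxy, neqE nyz).
have tT := embed_tight ci_F2 fi fa; have Ts := embed_tsym zf fv; have cT := embed_card fi.
have TE : f @: [set: zV F2] = K :|: t @^-1: K.
  apply/eqP; rewrite eqEcard cT card_ord cardsU disjoint_setI0 // cards0 (card_tpreim zf) cK andbT.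
  apply/subsetP => _ /imsetP[i _ ->]; rewrite inE !inE /f.
  by case: i => [[|[|[|[|[|[|[|[|?]]]]]]]] // ?]; rewrite /= ?tt ?vK ?xK ?yK ?zK ?orbT.
exists (f @: [set: zV F2]); split.
- apply/atomP; split=> // B sB Bs tB; apply/eqP; rewrite eqEsubset sB /=.
  have sB' : B \subset K :|: t @^-1: K by rewrite -TE.
  have c6 := tight_sym_card zf Bs tB.
  have BtK : B :&: t @^-1: K = t @^-1: (B :&: K) by apply/setP => p; rewrite !inE (tsymP _ _ Bs).
  have cB : #|B| <= 2 * #|B :&: K|.
    have {1}-> : B = (B :&: K) :|: (B :&: t @^-1: K) by rewrite -setIUr; apply/esym/setIidPl.
    rewrite (leq_trans (leq_card_setU _ _)) // BtK (card_tpreim zf); cnt_lia.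
  have [w wB wK] : exists2 w, w \in B & w \in K.
    have : 0 < #|B :&: K| by move: c6 cB; cnt_lia.
    by case/card_gt0P => w; rewrite inE => /andP[]; exists w.
  have [_ tI _] := tight_UI zf sp tB tK wB wK.
  have BK : B :&: K = K by apply: (sub_clique Kc cK (subsetIr _ _) tI); move: c6 cB; cnt_lia.
  rewrite TE subUset; apply/andP; split; first by rewrite -BK subsetIl.
  by rewrite -{1}BK -BtK subsetIl.
- by rewrite TE inE vK.
- by move=> e; apply: gen_F2; apply: embed_iso fa fv e.
Qed.

End BaseCopies.

(** * The induction step *)

Section Main.
Variables (V : finType) (r : rel V) (t : V -> V).
Hypothesis zf : z2free r t.
Hypothesis sp : sparse_on r setT.
Hypothesis tiV : tight r setT.
Hypothesis IH : forall G : z2graph, #|zV G| < #|V| -> ci G -> generated G.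
Let gs := z2_sym zf.
Let gi := z2_irr zf.
Let tt := z2_inv zf.
Let th := z2_hom zf.
Let tn := z2_nofix zf.
Let G0 := Z2Graph r t.

Lemma N3_pick v x y z p q : N3 r v x y z -> r v p -> r v q -> p != q -> exists w, N3 r v p q w.
Proof.
move=> N; have [_ vE] := N; rewrite !vE !inE.
have Nyzx := N3_rot N; have Nzxy := N3_rot Nyzx; have Nyxz := N3_swap N.
have Nxzy := N3_rot Nyxz; have Nzyx := N3_rot Nxzy.
by case/or3P=> /eqP->; case/or3P=> /eqP->; rewrite ?eqxx // => _; eexists; eassumption.
Qed.

(** If an edge joins the clique to its image, there is a copy of F2. If an outside vertex [u] has
    two neighbours in the clique, [v] is merged into [u]. Otherwise the clique is contracted. The
    neighbours of [v] are relabelled so that the ones concerned come first. *)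
Lemma triangle_case v x y z : N3 r v x y z -> r x y -> r x z -> r y z ->
  generated G0 \/ exists T, [/\ atom r t T, v \in T & T = setT -> generated G0].
Proof.
move=> N xy xz yz; have [Kc cK KE] := tri_clique zf N xy xz yz.
set K := [set q | _] in Kc cK KE.
have KP q : (q \in K) = (q == v) || r v q by rewrite inE.
clearbody K.
have vK : v \in K by rewrite KP eqxx.
have rK q : r v q -> q \in K by rewrite KP orbC => ->.
have nbr q : q \in K -> q != v -> r v q by rewrite KP => /orP[->|].
have dK := clique_disj zf Kc.
have tvK q : q \in K -> r v (t q) = false.
  by move=> qK; apply/negP => /rK tqK; have := disjointFr dK qK; rewrite inE tqK.
have pick p q : p \in K -> q \in K -> p != v -> q != v -> p != q ->
    exists w, [/\ N3 r v p q w, w \in K, r p w & r q w].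
  move=> pK qK pv qv pq; have [w Nw] := N3_pick N (nbr _ pK pv) (nbr _ qK qv) pq.
  have [_ npw nqw] := N3_neq Nw; have [_ _ vw] := N3_nbr Nw.
  by have wK := rK _ vw; exists w; split=> //; rewrite Kc.
case: (boolP [exists p in K, exists q in K, r p (t q)]) => [/existsP[p /andP[pK /existsP[q /andP[qK ptq]]]]|noX].
  right.
  have pv : p != v by apply: contraTneq ptq => ->; rewrite tvK.
  have qv : q != v by apply: contraTneq ptq => ->; rewrite -th tt gs tvK.
  have pq : p != q by apply: contraTneq ptq => ->; rewrite tn.
  have [w [Nw wK pw qw]] := pick p q pK qK pv qv pq.
  by apply: (F2_copy zf sp Nw _ pw qw ptq); rewrite Kc.
have nocross p q : p \in K -> q \in K -> r p (t q) = false.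
  move=> pK qK; apply/negP => ptq; case/existsP: noX; exists p; rewrite pK /=.
  by apply/existsP; exists q; rewrite qK.
left.
case: (boolP [exists u, (u \notin K) && [exists p in K, exists q in K, [&& p != q, r p u & r q u]]]) => [|none].
  case/existsP=> u /andP[uK /existsP[p /andP[pK /existsP[q /andP[qK /and3P[pq pu qu]]]]]].
  have pv : p != v by apply: contraNneq uK => e; apply: rK; rewrite -e.
  have qv : q != v by apply: contraNneq uK => e; apply: rK; rewrite -e.
  have [w [Nw wK pw qw]] := pick p q pK qK pv qv pq.
  have [uN vE] := Nw.
  have utw : u != t w by apply: contraTneq pu => ->; rewrite nocross.
  have spu := sp (subsetT (u |: K)); rewrite cntU1 // cardsU1 uK (cnt_clique Kc) cK in spu.
  have u0 : u |: K != set0 by apply/set0Pn; exists u; rewrite setU11.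
  (* Otherwise [u] and the clique would be five vertices with nine edges, where sparsity allows
     eight. *)
  have ruw : r u w = false.
    apply/negP => uw; have := spu u0.
    have npw : p != w by have [] := N3_neq Nw.
    have nqw : q != w by have [] := N3_neq Nw.
    have : cnt r [set u] [set q0 in [:: p; q; w]] <= cnt r [set u] K.
      by apply: cnt_subr; apply/subsetP => q0; rewrite !inE => /or3P[]/eqP->.
    rewrite (_ : [set u] = [set q0 in [:: u]]); last by apply/setP=> q0; rewrite !inE.
    rewrite cnt_seq // !big_cons !big_nil [r u p]gs [r u q]gs uw pu qu.
    by move: (cnt r _ K); clear; lia.
  apply: (red_C4 zf sp tiV IH uN vE (u := u)); rewrite ?ruw // 1?[r u _]gs //.
  - rewrite !inE negb_or; apply/andP; split; first by apply: contraNneq uK => ->.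
    by apply: contraTneq pu => ->; rewrite nocross.
  - by apply: contraNneq uK => ->.
  - by rewrite eq_sym inv_eqC // eq_sym in utw *; rewrite eq_sym.
  (* A tight [U] containing u and w meets the tight set [K], so no edge joins [K :\: U] to
     [U :\: K]. As p and q are adjacent to u, they lie in [U], which then contains all neighbours of
     [v]. *)
  - move=> U sU uU wU; apply/negP => tU.
    have [_ _ c0] := tight_UI zf sp (clique_tight Kc cK) tU wK wU.
    have pU : p \in U.
      apply: contraT => pU; have := cnt_eq0 c0 (x := p) (y := u).
      by rewrite !inE pK pU uK uU pu => /(_ isT isT).
    have qU : q \in U.
      apply: contraT => qU; have := cnt_eq0 c0 (x := q) (y := u).
      by rewrite !inE qK qU uK uU qu => /(_ isT isT).
    exact: (tight3 zf sp Nw tU (S_notv sU) pU qU wU).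
apply: (red_K4 zf sp tiV Kc vK cK rK nocross _ IH).
move=> u p q uK pK qK pu qu; apply/eqP; apply: contraNT none => pq.
apply/existsP; exists u; rewrite uK /=; apply/existsP; exists p; rewrite pK /=.
by apply/existsP; exists q; rewrite qK pq pu qu.
Qed.

Lemma node_atom v : deg r v = 3 ->
  generated G0 \/ exists T, [/\ atom r t T, v \in T & T = setT -> generated G0].
Proof.
move=> d3; have [g|[x [y [z [N [xy xz yz]]]]]|[x [z [N xz txz]]]] := node_cases zf sp tiV IH d3.
- by left.
- exact: triangle_case N xy xz yz.
- right; exact: (F1_copy zf N xz txz).
Qed.

(** Without vertices of degree 2, either all vertices of degree 3 lie in proper atoms and the graph
    is a join, or some vertex of degree 3 lies in none. In the latter case a reduction applies, or
    the atom found at that vertex is everything and the graph is F1 or F2. *)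
Lemma generated_step : generated G0.
Proof.
case: (boolP [exists v, deg r v == 2]) => [/existsP[v /eqP d2]|/existsPn n2].
  exact: (red_ext0 zf sp tiV IH d2).
have d3 v : 3 <= deg r v by rewrite ltn_neqAle eq_sym n2 (deg_ge2 zf sp tiV).
case: (boolP [forall v, (deg r v == 3) ==> [exists T, (atom r t T && (T != setT)) && (v \in T)]]).
  move=> /forallP H; apply: (atoms_split zf sp tiV IH d3) => v e.
  have := H v; rewrite e eqxx /= => /existsP[T /andP[/andP[aT TT] vT]].
  by exists T.
move=> /forallPn[v]; rewrite negb_imply => /andP[/eqP e nT].
have [//|[T [aT vT g]]] := node_atom e.
apply: g; apply/eqP; apply: contraNT nT => TT.
by apply/existsP; exists T; rewrite aT TT vT.
Qed.

End Main.

Lemma ci_generated (G : z2graph) : ci G -> generated G.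
Proof.
have [n] := ubnP #|zV G|; elim: n G => // n IH [V r t] /= ln [zf sp ti].
apply: generated_step zf sp ti _ => H lH; apply: IH.
by apply: leq_trans lH _.
Qed.

Theorem theorem5p10 (G : z2graph) :
  z2_wf G -> (ci_tight G <-> generated G).
Proof.
move=> wf; split=> [cG|/generated_ci/ciP[]//].
by apply: ci_generated; apply/ciP.
Qed.
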